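(* Let the orthogonal matrix $H\in\mathbb R^{L\times L}$ satisfy: for any binary vector $\omega\in\{0,1\}^L$, $\|H^T\omega\|_\infty\le\|\omega\|_1/\sqrt L$, and $H\mathbf 1=\sqrt L\,e_1$, where $\mathbf 1=(1,\dots,1)^T$ and $e_1=(1,0,\dots,0)^T$. Consider the DSBM where $G\in\mathcal G_{m,L,\nu_0}$ with $\nu_0>1/2$, $L\ge2$ and $n\ge2m$. Then, for any absolute constants $0<\aleph_1\le1\le\aleph_2<\infty$, one has $$\inf_{\hat\Lambda}\ \sup_{\substack{G\in\mathcal G_{m,L,\nu_0}\\ C\in\mathcal Z_{\rm bal}}}\mathbb P_\Lambda\left\{\frac{\|\hat\Lambda-\Lambda\|^2}{n^2L}\ge C_0\left[\min\left\{\frac1L\Big[\Big(\frac mn\Big)^2\Big]^{\frac{2\nu_0}{2\nu_0+1}};\Big(\frac mn\Big)^2\right\}+\frac{\log m}{nL}+\frac{n_0}{n^2}\log\Big(\frac{mne}{n_0}\Big)\right]\right\}\ge\frac14,$$ where $\mathcal Z_{\rm bal}$ stands for $\mathcal Z_{\rm bal}(m,n,n_0,L,\aleph_1,\aleph_2)$, $\hat\Lambda$ is any estimator of $\Lambda$, $\mathbb P_\Lambda$ is the probability under the true value of the tensor $\Lambda$, and $C_0$ is an absolute constant independent of $n$, $m$ and $L$.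
   Context: Observations: $B_{i,j,l}\in\{0,1\}$ for $1\le i,j\le n$, $1\le l\le L$, with $B_{i,j,l}=B_{j,i,l}$, $B_{i,i,l}=0$, and $\{B_{i,j,l}: i<j,\ 1\le l\le L\}$ independent Bernoulli variables with $\mathbb P_\Lambda(B_{i,j,l}=1)=\Lambda_{i,j,l}$. Estimators $\hat\Lambda$ are functions of $B$. Clustering: $\mathcal M(m,n)$ is the set of $Z\in\{0,1\}^{n\times m}$ with exactly one 1 in each row ($Z_{ik}=1$ iff node $i$ is in class $\Omega_k$). $\mathcal Z_{\rm bal}(m,n,n_0,L,\aleph_1,\aleph_2)$ is the set of sequences $(Z^{(1)},\dots,Z^{(L)})\in\prod_{l=1}^L\mathcal M(m,n)$ such that at most $n_0$ nodes change class between two consecutive times and $\aleph_1n/m\le n_k^{(l)}\le\aleph_2n/m$ for all $k=1,\dots,m$, $l=1,\dots,L$, with $n_k^{(l)}$ the number of nodes in class $k$ at time $l$; such a sequence is denoted $C$. DSBM: a connectivity tensor $G\in[0,1]^{m\times m\times L}$ with $G_{k,k',l}=G_{k',k,l}$ and a sequence $C$ of clustering matrices determine $\Lambda$ by $\Lambda_{i,j,l}=G_{k,k',l}$ for $i\neq j$ if $i\in\Omega_k$ and $j\in\Omega_{k'}$ at time $l$, and $\Lambda_{i,i,l}=0$. Smoothness class: $M=m(m+1)/2$; $Q\in\mathbb R^{M\times L}$ is the matrix whose $l$-th column is the vector of entries $G_{k_1,k_2,l}$ with $k_1\le k_2$; $D=QH^T$, i.e. $Q=DH$. For a fixed constant $K_0>0$,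 $\mathcal G_{m,L,\nu_0}$ is the collection of connectivity tensors $G$ for which $\sum_{l=1}^L(l-1)^{2\nu_0}D_{k,l}^2\le K_0$ for all $k=1,\dots,M$. $\|\cdot\|$ for tensors is the square root of the sum of squared entries. The term $n_0\log(mne/n_0)$ is $0$ if $n_0=0$.
   Formalization: The formal theorem also assumes m ≥ 1, n0 ≤ n, that Z_bal is nonempty, and, if n0 > 0, that some clustering sequence in Z_bal changes over time; otherwise the claim fails, e.g. for m = 1, n0 = n with n large, or when the supremum is over an empty set. *)

(* Defs.v *)
From mathcomp Require Import all_boot all_order all_algebra.
From mathcomp Require Import classical_sets reals constructive_ereal ereal.
From mathcomp Require Import sequences exp.

Set Implicit Arguments.
Unset Strict Implicit.
Unset Printing Implicit Defensive.

Import Order.TTheory GRing.Theory Num.Theory.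

Local Open Scope ring_scope.

(* p x p x L tensors; the time index runs over 0, .., L-1 instead of
   1, .., L. *)
Notation tensor T p L := {ffun 'I_p * 'I_p * 'I_L -> T}.

Section Observations.
Context {R : realType} (n L : nat).

Definition sqnorm (X : tensor R n L) : R := \sum_a X a ^+ 2.

Definition adjacency (B : tensor bool n L) : bool :=
  [forall i, forall j, forall l, B (i, j, l) == B (j, i, l)]
  && [forall i, forall l, ~~ B (i, i, l)].

(* The law of B: only the entries above the diagonal are free, and they are
   independent Bernoulli variables. *)
Definition obs_pmf (Lam : tensor R n L) (B : tensor bool n L) : R :=
  if adjacency B then
    \prod_(l < L) \prod_(i < n) \prod_(j < n | (i < j)%N)
      (if B (i, j, l) then Lam (i, j, l) else 1 - Lam (i, j, l))
  else 0.

Definition Pr (Lam : tensor R n L) (E : pred (tensor bool n L)) : R :=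
  \sum_(B : tensor bool n L | E B) obs_pmf Lam B.

End Observations.

Section Clustering.
Context {R : realType} (m n L : nat).

Definition clustering (Z : 'M[bool]_(n, m)) : Prop :=
  forall i : 'I_n, #|[set k : 'I_m | Z i k]| = 1%N.

Definition class_size (Z : 'M[bool]_(n, m)) (k : 'I_m) : nat :=
  #|[set i : 'I_n | Z i k]|.

Definition movers (Z Z' : 'M[bool]_(n, m)) : {set 'I_n} :=
  [set i : 'I_n | row i Z != row i Z'].

Definition Zbal (n0 : nat) (al1 al2 : R) : set ('I_L -> 'M[bool]_(n, m)) :=
  [set C : 'I_L -> 'M[bool]_(n, m) |
    [/\ forall l, clustering (C l),
        forall l l' : 'I_L, l' = l.+1 :> nat ->
          (#|movers (C l) (C l')| <= n0)%N
      & forall l k, al1 * n%:R / m%:R <= (class_size (C l) k)%:R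
                                      <= al2 * n%:R / m%:R]].

End Clustering.

Arguments Zbal {R} m n L.

Section Connectivity.
Context {R : realType} (m L : nat).

Definition connectivity (G : tensor R m L) : Prop :=
  (forall a, 0 <= G a <= 1) /\
  (forall k k' l, G (k, k', l) = G (k', k, l)).

Definition upair : predArgType := {k : 'I_m * 'I_m | (k.1 <= k.2)%N}.

(* The rows of Q are indexed by the pairs k1 <= k2 in some enumeration of
   these pairs, there being m(m+1)/2 of them (card_upair below). *)
Definition Qmx (G : tensor R m L) : 'M[R]_(#|{: upair}|, L) :=
  \matrix_(k, l) let p := val (enum_val k) in G (p.1, p.2, l).

(* The exponent 2 nu0 is real.  Since l is counted from 0 it plays the role of
   l-1 in the weight (l-1)^(2 nu0); this weight vanishes at l = 0, as
   0 `^ x = 0 for x != 0. *)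
Definition smooth_class (H : 'M[R]_L) (nu0 K0 : R) : set (tensor R m L) :=
  [set G : tensor R m L | connectivity G /\
    let D := Qmx G *m H^T in
    forall k, \sum_(l < L) (l%:R `^ (2 * nu0)) * D k l ^+ 2 <= K0].

End Connectivity.

Lemma card_upair m : #|{: upair m}| = (m * m.+1)./2.
Proof.
rewrite card_sig -sum1_card.
rewrite (eq_bigl (fun k : 'I_m * 'I_m => true && (k.1 <= k.2)%N)) //.
rewrite -(pair_big_dep xpredT (fun i j : 'I_m => (i <= j)%N) (fun _ _ => 1%N)).
rewrite (exchange_big_dep xpredT) //=.
under eq_bigr => j _.
  rewrite (eq_bigl (fun i : 'I_m => (i < j.+1)%N)) //.
  rewrite (big_ord_narrow (ltn_ord j)) sum1_card card_ord.
  over.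
elim: m => [|m IH]; first by rewrite big_ord0.
rewrite big_ord_recr IH.
have -> : (m.+1 * m.+2 = m * m.+1 + m.+1.*2)%N.
  by rewrite -muln2 [(m * _)%N]mulnC -mulnDr addn2.
by rewrite halfD odd_double andbF add0n doubleK.
Qed.

Section DSBM.
Context {R : realType} (m n L : nat).

Definition dsbm_tensor (G : tensor R m L) (C : 'I_L -> 'M[bool]_(n, m))
    (Lam : tensor R n L) : Prop :=
  (forall i l, Lam (i, i, l) = 0) /\
  (forall i j l k k', i != j -> C l i k -> C l j k' ->
    Lam (i, j, l) = G (k, k', l)).

Definition dsbm_class (GG : set (tensor R m L))
    (CC : set ('I_L -> 'M[bool]_(n, m))) : set (tensor R n L) :=
  [set Lam | exists G C, [/\ GG G, CC C & dsbm_tensor G C Lam]].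

End DSBM.

Section Transform.
Context {R : realType} (L : nat).

Definition orthogonal_mx (H : 'M[R]_L) : Prop := H *m H^T = 1%:M.

Definition flat_on_binary (H : 'M[R]_L) : Prop :=
  forall w : 'cV[R]_L, (forall i, w i 0 = 0 \/ w i 0 = 1) ->
  forall i, `|(H^T *m w) i 0| <= (\sum_j `|w j 0|) / Num.sqrt L%:R.

Definition maps_ones_to_e1 (H : 'M[R]_L) : Prop :=
  H *m const_mx 1 = Num.sqrt L%:R *: (\col_(i < L) (i == 0 :> nat)%:R).

End Transform.

(* At n0 = 0 the last term is 0. *)
Definition rate {R : realType} (m n L n0 : nat) (nu0 : R) : R :=
  let x := (m%:R / n%:R) ^+ 2 in
  Num.min (L%:R^-1 * x `^ (2 * nu0 / (2 * nu0 + 1))) x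
  + ln m%:R / (n%:R * L%:R)
  + n0%:R / n%:R ^+ 2 * ln (m%:R * n%:R * expR 1 / n0%:R).

(* Main.v *)
(* Lower bound by testing many hypotheses.  Let N tensors Lam_j be all close to a
   tensor Lam_0 with entries in [1/4, 3/4].  Then E_0 (dP_j / dP_0)^2 is at most
   exp (6 |Lam_j - Lam_0|^2), and by Cauchy-Schwarz an estimator that is within
   distance sqrt s of Lam_j with P_j-probability more than 3/4 for all j forces
   N / K < 16/9 exp (6 max_j |Lam_j - Lam_0|^2), where K bounds the number of
   hypotheses in a ball of radius 2 sqrt s.  For product families K is estimated
   by an exponential moment of the distance, so no explicit packing is needed.

   The rate is a sum of three terms, and it is enough to bound each of them.
   - Connectivity: the clusters are fixed and balanced, and the frequencies
     1, .., T of each row of Q are switched on or off with amplitude of order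
     m / n, T being of order min (L, (n / m)^(2 / (2 nu0 + 1))).
   - Clustering, static and dynamic: the connectivity is constant in time and
     given by a Hadamard matrix of amplitude delta, and the labels are permuted by
     sparse permutations within rows of nodes, which keeps all class sizes; there
     are at least (c m n / h)^(c h) such permutations moving at most h nodes.  In
     the static case h = n and the labels do not depend on time; in the dynamic
     case h = n0, and the labels are permuted independently at the odd times.  For
     n0 = 1 a permutation is impossible, and single moves are used instead. *)
Require Import Defs.
From mathcomp Require Import all_boot all_order all_fingroup all_algebra.
From mathcomp Require Import mathcomp_extra boolp classical_sets reals.
From mathcomp Require Import constructive_ereal ereal sequences exp.
From mathcomp Require Import zify ring lra.
Set Implicit Arguments.
Unset Strict Implicit.
Unset Printing Implicit Defensive.
Import Order.TTheory GRing.Theory Num.Theory.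
Local Open Scope ring_scope.

(** * Testing *)

Lemma ler_sum_inj (R : realType) (A B : finType) (h : A -> B) (f : B -> R) :
  injective h -> (forall b, 0 <= f b) -> \sum_a f (h a) <= \sum_b f b.
Proof.
move=> h_inj f0; rewrite (eq_bigl (fun a => a \in [set: A]%SET)) => [|a]; last by rewrite inE.
rewrite -(big_imset f (A := [set: A]%SET)) /=; last by move=> a a' _ _; exact: h_inj.
by rewrite [leRHS](bigID (fun b => b \in h @: [set: A]%SET)) /= lerDl sumr_ge0.
Qed.

Section Testing.
Context {R : realType} (n L : nat).
Implicit Types (B : tensor bool n L) (Lam : tensor R n L).

Definition above_diag (a : 'I_n * 'I_n * 'I_L) : bool := (a.1.1 < a.1.2)%N.

Definition swap_ends (a : 'I_n * 'I_n * 'I_L) := (a.1.2, a.1.1, a.2).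

Lemma obs_pmfE Lam B : adjacency B ->
  obs_pmf Lam B = \prod_(a | above_diag a) (if B a then Lam a else 1 - Lam a).
Proof.
move=> adjB; rewrite /obs_pmf adjB.
transitivity (\prod_(l < L) \prod_(e : 'I_n * 'I_n | (e.1 < e.2)%N)
    (if B (e, l) then Lam (e, l) else 1 - Lam (e, l))).
  by apply: eq_bigr => l _; rewrite pair_big_dep /=; apply: eq_big => [[i j]|[i j] _].
rewrite exchange_big pair_big_dep /=.
by apply: eq_big => [[[i j] l]|[[i j] l] _]; rewrite ?andbT.
Qed.

(** An adjacency tensor is the same thing as a free choice of bits above the diagonal: [upp]
    restricts, [sym] extends by symmetry. Distributivity then turns the sum over all choices into a
    product. *)
Lemma sum_adjacency (F : 'I_n * 'I_n * 'I_L -> bool -> R) :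
  \sum_(B : tensor bool n L | adjacency B) \prod_(a | above_diag a) F a (B a) =
  \prod_(a | above_diag a) (F a true + F a false).
Proof.
under [RHS]eq_bigr do rewrite -big_bool.
rewrite (big_distr_big_dep false) /=.
pose sym (f : tensor bool n L) : tensor bool n L := [ffun a => f a || f (swap_ends a)].
pose upp B : tensor bool n L := [ffun a => above_diag a && B a].
rewrite (reindex_onto sym upp) /=; last first.
  move=> B /andP[/forallP symB /forallP diagB].
  apply/ffunP => -[[i j] l]; rewrite !ffunE /swap_ends /above_diag /=.
  move/forallP: (symB i) => /(_ j)/forallP/(_ l)/eqP <-.
  case: (ltngtP i j) => //= ij; first by rewrite orbF.
  by move/forallP: (diagB i) => /(_ l); rewrite (val_inj ij) => /negbTE ->.
apply: eq_big => [f|f].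
- apply/idP/idP.
    move=> /andP[_ /eqP <-]; apply/pfamilyP; split=> [|//].
    by apply/supportP => a; rewrite unfold_in ffunE /above_diag => /negbTE ->.
  move=> /pfamilyP[/supportP sf _]; apply/andP; split; last first.
    apply/eqP/ffunP => -[[i j] l]; rewrite !ffunE.
    rewrite /above_diag /=; case: ltnP => ij /=.
      by rewrite (sf (swap_ends _)) ?orbF // unfold_in /= -leqNgt ltnW.
    by rewrite sf // unfold_in /= -leqNgt.
  apply/andP; split.
    do 3!apply/forallP => ?; rewrite !ffunE /swap_ends /=; exact/eqP/orbC.
  by do 2!apply/forallP => ?; rewrite !ffunE orbb sf // unfold_in /above_diag /= ltnn.
- move=> /andP[_ /eqP uf]; apply: eq_bigr => a ua.
  by rewrite -{2}uf [in RHS]ffunE ua.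
Qed.

Definition prob_tensor Lam := forall a, above_diag a -> 0 <= Lam a <= 1.

Lemma obs_pmf_ge0 Lam B : prob_tensor Lam -> 0 <= obs_pmf Lam B.
Proof.
move=> Lam01; have [adjB|nadj] := boolP (adjacency B); last first.
  by rewrite /obs_pmf (negbTE nadj).
rewrite obs_pmfE //; apply: prodr_ge0 => a /Lam01/andP[? ?].
by case: ifP; lra.
Qed.

Lemma sum_obs_pmf Lam : \sum_B obs_pmf Lam B = 1.
Proof.
rewrite (bigID (@adjacency n L)) /= [X in _ + X]big1 ?addr0; last first.
  by move=> B /negbTE nadj; rewrite /obs_pmf nadj.
under eq_bigr do rewrite obs_pmfE //.
rewrite (sum_adjacency (fun a b => if b then Lam a else 1 - Lam a)).
by rewrite big1 // => a _; ring.
Qed.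

(** By independence the left side factors over the entries above the diagonal, each factor being 1 +
    (x - y)^2 / (y (1 - y)), and 1 + u <= exp u. *)
Lemma sum_chi2 Lam Lam0 :
  prob_tensor Lam -> (forall a, above_diag a -> 4^-1 <= Lam0 a <= 3 / 4) ->
  \sum_(B | adjacency B) obs_pmf Lam B ^+ 2 / obs_pmf Lam0 B <=
  expR (6 * sqnorm (Lam - Lam0)).
Proof.
move=> Lam01 Lam0b.
pose F a b := (if b then Lam a else 1 - Lam a) ^+ 2 / (if b then Lam0 a else 1 - Lam0 a).
rewrite (eq_bigr (fun B : tensor bool n L => \prod_(a | above_diag a) F a (B a))); last first.
  by move=> B adjB; rewrite !obs_pmfE // -prodrXl -prodf_div.
rewrite sum_adjacency {}/F.
apply: (@le_trans _ _ (\prod_(a | above_diag a) expR (6 * (Lam a - Lam0 a) ^+ 2))).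
  apply: ler_prod => a ua; have := Lam01 a ua; have := Lam0b a ua.
  move: (Lam a) (Lam0 a) => x y /andP[y1 y2] /andP[x1 x2].
  apply/andP; split.
    by apply: addr_ge0; apply: divr_ge0; rewrite ?sqr_ge0 //; lra.
  apply: le_trans (expR_ge1Dx _).
  have -> : x ^+ 2 / y + (1 - x) ^+ 2 / (1 - y) = 1 + (x - y) ^+ 2 / (y * (1 - y)).
    by field; apply/andP; split; apply/negP => /eqP; lra.
  (* In fact y (1 - y) >= 3/16 on [1/4, 3/4]; the bound 1/6 gives the constant 6 of the exponent. *)
  have yy : 6^-1 <= y * (1 - y).
    have : 0 <= (y - 4^-1) * (3 / 4 - y) by apply: mulr_ge0; lra.
    lra.
  rewrite lerD2l ler_pdivrMr; last by lra.
  have := ler_wpM2l (sqr_ge0 (x - y)) yy; lra.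
rewrite -expR_sum ler_expR -mulr_sumr ler_wpM2l // /sqnorm.
rewrite [leRHS](bigID above_diag) /= -[leLHS]addr0 lerD ?sumr_ge0 //; last first.
  by move=> a _; exact: sqr_ge0.
by apply: ler_sum => a _; rewrite !ffunE.
Qed.

Lemma Pr_compl Lam (E : pred (tensor bool n L)) :
  Pr Lam E = 1 - Pr Lam (predC E).
Proof. by rewrite -(sum_obs_pmf Lam) (bigID E) /= addrK. Qed.

Lemma le_Pr Lam (E E' : pred (tensor bool n L)) :
  prob_tensor Lam -> (forall B, E B -> E' B) -> Pr Lam E <= Pr Lam E'.
Proof.
move=> Lam01 EE'; rewrite /Pr [leLHS]big_mkcond [leRHS]big_mkcond.
apply: ler_sum => B _; case: ifP => [/EE' ->//|_].
by case: ifP => // _; exact: obs_pmf_ge0.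
Qed.

Lemma sqnormB_lt4 (X Y Z : tensor R n L) (s : R) :
  sqnorm (X - Y) < s -> sqnorm (X - Z) < s -> sqnorm (Y - Z) < 4 * s.
Proof.
move=> XY XZ.
apply: (@le_lt_trans _ _ (2 * sqnorm (X - Y) + 2 * sqnorm (X - Z))); last by lra.
rewrite /sqnorm !mulr_sumr -big_split /=; apply: ler_sum => a _.
rewrite !ffunE; move: (X a) (Y a) (Z a) => x y z.
have := sqr_ge0 ((x - y) + (x - z)); nra.
Qed.

Lemma amgm_div (x y lam : R) : 0 < y -> 0 < lam ->
  x <= x ^+ 2 / y / (2 * lam) + lam / 2 * y.
Proof.
move=> y0 lam0; rewrite -subr_ge0.
have -> : x ^+ 2 / y / (2 * lam) + lam / 2 * y - x = (x - lam * y) ^+ 2 / (2 * lam * y).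
  by field; rewrite (gt_eqF y0) (gt_eqF lam0).
by rewrite divr_ge0 ?sqr_ge0 // !mulr_ge0 // ltW.
Qed.

(* Cauchy-Schwarz against the law of Lam0, in the AM-GM form
   p <= p^2 / (2 lam p0) + lam p0 / 2. *)
Lemma testing_bound (I : finType) (Lam : I -> tensor R n L) (Lam0 : tensor R n L)
    (s : R) (K : R) (hatLam : tensor bool n L -> tensor R n L) :
  (0 < #|I|)%N -> 0 < K ->
  (forall j, prob_tensor (Lam j)) ->
  (forall a, above_diag a -> 4^-1 <= Lam0 a <= 3 / 4) ->
  (forall j, #|[pred k | sqnorm (Lam j - Lam k) < 4 * s]|%:R <= K) ->
  (forall j, expR (6 * sqnorm (Lam j - Lam0)) * K <= 9 / 16 * #|I|%:R) ->
  exists j, 4^-1 <= Pr (Lam j) (fun B => s <= sqnorm (hatLam B - Lam j)).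
Proof.
move=> I0 K0 Lam01 Lam0b ball chi.
have N0 : 0 < #|I|%:R :> R by rewrite ltr0n.
set N : R := #|I|%:R in N0 chi.
have Lam001 : prob_tensor Lam0 by move=> a /Lam0b/andP[? ?]; apply/andP; split; lra.
have sumc (c : R) : \sum_(j : I) c = c * N.
  by rewrite sumr_const cardT -cardE mulr_natr.
pose A j B := sqnorm (hatLam B - Lam j) < s.
suff : \sum_j Pr (Lam j) (A j) <= 3 / 4 * N.
  move=> sumA; apply/existsP; apply: contraT => /existsPn noj; exfalso.
  suff : 3 / 4 * N < \sum_j Pr (Lam j) (A j) by lra.
  rewrite -sumc.
  have [i0 _] := card_gt0P I0.
  apply: ltr_sum => [|j _]; first by apply/hasP; exists i0 => //; rewrite mem_index_enum.
  have := noj j; rewrite -ltNge Pr_compl.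
  have -> : Pr (Lam j) (predC (fun B => s <= sqnorm (hatLam B - Lam j))) =
            Pr (Lam j) (A j) by apply: eq_bigl => B; rewrite /A /= -ltNge.
  by lra.
(* This weight balances the two parts of the AM-GM bound: each contributes 3/8 N after summing over
   the hypotheses. *)
pose lam := 3 / 4 * N / K.
have lam0 : 0 < lam by rewrite divr_gt0 // mulr_gt0.
have step j B : obs_pmf (Lam j) B <=
    (if adjacency B then obs_pmf (Lam j) B ^+ 2 / obs_pmf Lam0 B else 0) / (2 * lam)
    + lam / 2 * obs_pmf Lam0 B.
  case: ifP => adjB; last by rewrite /obs_pmf adjB !(mul0r, mulr0, addr0).
  have : 0 < obs_pmf Lam0 B.
    rewrite obs_pmfE //; apply: prodr_gt0 => a /Lam0b/andP[? ?].
    by case: ifP; lra.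
  by move=> y0; exact: amgm_div.
apply: (@le_trans _ _ (\sum_(j : I) (9 / 16 * N / K / (2 * lam))
    + lam / 2 * \sum_B \sum_(j | A j B) obs_pmf Lam0 B)).
  rewrite [X in _ + _ * X](exchange_big_dep xpredT) //= mulr_sumr.
  rewrite -big_split /=; apply: ler_sum => j _.
  apply: (@le_trans _ _ (\sum_(B | A j B) ((if adjacency B then
     obs_pmf (Lam j) B ^+ 2 / obs_pmf Lam0 B else 0) / (2 * lam)
    + lam / 2 * obs_pmf Lam0 B))); first by apply: ler_sum => B _; exact: step.
  rewrite big_split /= -mulr_sumr lerD // -mulr_suml ler_pM2r; last first.
    by rewrite invr_gt0 mulr_gt0.
  rewrite ler_pdivlMr //; apply: le_trans (chi j).
  rewrite ler_pM2r //; apply: le_trans (sum_chi2 (Lam01 j) Lam0b).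
  rewrite -big_mkcondr /= [leLHS]big_mkcond [leRHS]big_mkcond /=.
  apply: ler_sum => B _; case: (A j B); case: ifP => //= _.
  by rewrite divr_ge0 ?sqr_ge0 ?obs_pmf_ge0.
(* All hypotheses within sqrt s of one estimate lie in a ball of radius 2 sqrt s around any of them,
   so each observation is counted at most [K] times. *)
have : \sum_B \sum_(j | A j B) obs_pmf Lam0 B <= K.
  apply: (@le_trans _ _ (\sum_B K * obs_pmf Lam0 B)); last first.
    by rewrite -mulr_sumr sum_obs_pmf mulr1.
  apply: ler_sum => B _; rewrite sumr_const -mulr_natl ler_wpM2r ?obs_pmf_ge0 //.
  have [j Aj|none] := pickP (A ^~ B); last by rewrite eq_card0 // ltW.
  apply: le_trans (ball j); rewrite ler_nat; apply: subset_leq_card.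
  by apply/fintype.subsetP => k Ak; rewrite inE; exact: sqnormB_lt4 Aj Ak.
move=> cover; rewrite sumc.
have -> : 9 / 16 * N / K / (2 * lam) * N = 3 / 8 * N.
  by rewrite /lam; field; rewrite !gt_eqF.
have : lam / 2 * (\sum_B \sum_(j | A j B) obs_pmf Lam0 B) <= lam / 2 * K.
  by rewrite ler_pM2l // divr_gt0.
have -> : lam / 2 * K = 3 / 8 * N by rewrite /lam; field; rewrite gt_eqF.
by lra.
Qed.

End Testing.

(** * Testing over product families of hypotheses *)

Section ProductTesting.
Context {R : realType} (n L : nat).

(** Chernoff bound for the counting measure: the indicator of the ball is at most exp (t (r - d)),
    and the sum of this exponential over all [g] factors over the coordinates. *)
Lemma card_ball_le (S A : finType) (dd : A -> A -> R) (t e r : R) :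
  0 <= t ->
  (forall a, \sum_b expR (- t * dd a b) <= expR e) ->
  forall f : {ffun S -> A},
    #|[pred g : {ffun S -> A} | \sum_s dd (f s) (g s) < r]|%:R <=
    expR (t * r + #|S|%:R * e).
Proof.
move=> t0 sumdd f.
have -> : #|[pred g : {ffun S -> A} | \sum_s dd (f s) (g s) < r]|%:R =
    \sum_(g : {ffun S -> A} | \sum_s dd (f s) (g s) < r) (1 : R).
  by rewrite sumr_const.
apply: (@le_trans _ _ (\sum_(g : {ffun S -> A})
    expR (t * r) * \prod_s expR (- t * dd (f s) (g s)))).
  rewrite big_mkcond; apply: ler_sum => g _.
  rewrite -expR_sum -mulr_sumr -expRD; case: ifP => [lt_r|_]; last exact: expR_ge0.
  rewrite -[leLHS]expR0 ler_expR mulNr -mulrBr mulr_ge0 // subr_ge0; exact: ltW.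
rewrite -mulr_sumr expRD ler_pM2l ?expR_gt0 //.
rewrite -(bigA_distr_bigA (fun s b => expR (- t * dd (f s) b))) expRM_natl.
rewrite -[leRHS]prodr_const; apply: ler_prod => s _.
by rewrite sumdd sumr_ge0 // => b _; exact: expR_ge0.
Qed.

(** Sixth powers are compared: (16/9)^6 < 32 = 2^5. *)
Lemma expR_ln2_56 : 16 / 9 <= expR (5 / 6 * ln 2) :> R.
Proof.
rewrite leNgt; apply/negP => lt.
have : expR (5 / 6 * ln 2) ^+ 6 < (16 / 9) ^+ 6 :> R by rewrite ltrXn2r ?expR_ge0 //; lra.
rewrite -expRM_natl (_ : 6%:R * (5 / 6 * ln 2) = 5%:R * ln 2 :> R); last by field.
by rewrite expRM_natl lnK ?posrE //; lra.
Qed.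

(** With X = |S| ln |A| there are exp X hypotheses. The chi-square factor costs exp (X/18) and the
    ball, of [dd]-radius X / (18 t), costs exp (X/9). This leaves exp (5X/6) >= 2^(5/6) >= 16/9, as
    [testing_bound] requires. *)
Lemma product_testing (S A : finType) (Lam : {ffun S -> A} -> tensor R n L)
    (Lam0 : tensor R n L) (dd : A -> A -> R) (t gam : R)
    (hatLam : tensor bool n L -> tensor R n L) :
  (0 < #|S|)%N -> (1 < #|A|)%N -> 0 < t -> 0 < gam ->
  (forall f, prob_tensor (Lam f)) ->
  (forall a, above_diag a -> 4^-1 <= Lam0 a <= 3 / 4) ->
  (forall f g : {ffun S -> A}, gam * \sum_s dd (f s) (g s) <= sqnorm (Lam f - Lam g)) ->
  (forall a, \sum_b expR (- t * dd a b) <= expR (ln #|A|%:R / 18)) ->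
  (forall f, 6 * sqnorm (Lam f - Lam0) <= #|S|%:R * ln #|A|%:R / 18) ->
  exists f, 4^-1 <= Pr (Lam f) (fun B =>
    gam * (#|S|%:R * ln #|A|%:R) / (72 * t) <= sqnorm (hatLam B - Lam f)).
Proof.
move=> S0 A1 t0 gam0 Lam01 Lam0b sep ball chi.
have A2 : ln 2 <= ln #|A|%:R :> R.
  by rewrite ler_ln ?posrE ?ltr0n ?(ltn_trans _ A1) // ler_nat.
have S1 : 1 <= #|S|%:R :> R by rewrite ler1n.
have ln20 : 0 < ln 2 :> R by rewrite ln_gt0 // ltr1n.
pose X : R := #|S|%:R * ln #|A|%:R.
have X2 : ln 2 <= X.
  by apply: (le_trans A2); apply: ler_peMl => //; exact: le_trans (ltW ln20) A2.
have cardX : #|{ffun S -> A}|%:R = expR X.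
  by rewrite card_ffun natrX /X expRM_natl lnK // posrE ltr0n ltnW.
apply: (@testing_bound R n L {ffun S -> A} Lam Lam0 (gam * X / (72 * t))
  (expR (X / 9))) => //.
- by rewrite card_ffun expn_gt0 ltnW.
- exact: expR_gt0.
- move=> f.
  have := @card_ball_le S A dd t (ln #|A|%:R / 18) (X / (18 * t)) (ltW t0) ball f.
  rewrite (_ : t * (X / (18 * t)) + #|S|%:R * (ln #|A|%:R / 18) = X / 9); last first.
    by rewrite /X; field; rewrite (gt_eqF t0).
  apply: le_trans; rewrite ler_nat; apply: subset_leq_card.
  apply/fintype.subsetP => g; rewrite !inE => /(le_lt_trans (sep f g)).
  rewrite (_ : 4 * _ = gam * (X / (18 * t))); first by rewrite ltr_pM2l.
  by rewrite /X; field; rewrite (gt_eqF t0).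
- move=> f; rewrite cardX -expRD.
  apply: (@le_trans _ _ (expR (X / 6))).
    by rewrite ler_expR; have := chi f; rewrite -/X; lra.
  have -> : expR X = expR (X / 6) * expR (5 / 6 * X) by rewrite -expRD; congr expR; field.
  have : expR (5 / 6 * ln 2) <= expR (5 / 6 * X) by rewrite ler_expR; lra.
  have := expR_ln2_56; have := expR_gt0 (X / 6); nra.
Qed.

End ProductTesting.

(** * Balanced labelings *)

Section Labelings.
Context {n m : nat}.
Implicit Types z : 'I_n -> 'I_m.

Definition label_mx z : 'M[bool]_(n, m) := \matrix_(i, k) (z i == k).

Lemma label_mx_clustering z : clustering (label_mx z).
Proof.
move=> i; rewrite (_ : [set k | _] = [set z i]) ?cards1 //.
by apply/setP => k; rewrite !inE mxE eq_sym.
Qed.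

Lemma class_size_label_mx z k : class_size (label_mx z) k = #|[pred i | z i == k]|.
Proof.
by rewrite /class_size -sum1dep_card -sum1_card; apply: eq_bigl => i; rewrite mxE.
Qed.

Lemma movers_label_mx z z' :
  #|movers (label_mx z) (label_mx z')| = #|[pred i | z i != z' i]|.
Proof.
rewrite /movers -sum1dep_card -sum1_card; apply: eq_bigl => i; rewrite inE; congr negb.
apply/eqP/eqP => [/rowP/(_ (z i))|zz]; last by apply/rowP => k; rewrite !mxE zz.
by rewrite !mxE eqxx => /esym/eqP.
Qed.

Lemma class_sizeE (Z : 'M[bool]_(n, m)) k : class_size Z k = (\sum_(i < n) Z i k)%N.
Proof. by rewrite /class_size -sum1dep_card big_mkcond. Qed.

Lemma sum_class_size (Z : 'M[bool]_(n, m)) :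
  clustering Z -> (\sum_(k < m) class_size Z k)%N = n.
Proof.
move=> clZ; under eq_bigr do rewrite class_sizeE.
rewrite exchange_big /= -[RHS]card_ord -sum1_card; apply: eq_bigr => i _.
by rewrite -(clZ i) -sum1dep_card [RHS]big_mkcond.
Qed.

Lemma class_le_quotient (Z : 'M[bool]_(n, m)) :
  (0 < m)%N -> clustering Z -> exists k, (class_size Z k <= n %/ m)%N.
Proof.
move=> m0 /sum_class_size sumZ; apply/existsP; apply: contraT => /existsPn big.
have : (\sum_(k < m) (n %/ m).+1 <= \sum_(k < m) class_size Z k)%N.
  by apply: leq_sum => k _; rewrite ltnNge big.
by rewrite sumZ sum_nat_const card_ord mulnC leqNgt ltn_ceil.
Qed.

Lemma class_gt_quotient (Z : 'M[bool]_(n, m)) :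
  (0 < n %% m)%N -> clustering Z -> exists k, (n %/ m < class_size Z k)%N.
Proof.
move=> r0 /sum_class_size sumZ; apply/existsP; apply: contraT => /existsPn small.
have : (\sum_(k < m) class_size Z k <= \sum_(k < m) (n %/ m))%N.
  by apply: leq_sum => k _; rewrite leqNgt small.
rewrite sumZ sum_nat_const card_ord {1}(divn_eq n m) mulnC; lia.
Qed.

Lemma unequal_classes (Z : 'M[bool]_(n, m)) k :
  (m %| n)%N -> clustering Z -> class_size Z k != (n %/ m)%N ->
  (exists k1, class_size Z k1 < n %/ m)%N /\ (exists k2, n %/ m < class_size Z k2)%N.
Proof.
move=> /divnK mn /sum_class_size sumZ neq.
have sumq : (\sum_(k < m) (n %/ m) = n)%N by rewrite sum_nat_const card_ord mulnC.
have {sumq}sumZ := etrans sumZ (esym sumq); move: sumZ neq.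
rewrite (bigD1 k) //= [X in _ = X](bigD1 k) //=.
move=> sumZ neq.
have {}sumZ : (class_size Z k + \sum_(i < m | i != k) class_size Z i =
  n %/ m + \sum_(i < m | i != k) (n %/ m))%N := sumZ.
split; apply/existsP; apply: contraT => /existsPn none.
- have : (\sum_(i < m | i != k) (n %/ m) <= \sum_(i < m | i != k) class_size Z i)%N.
    by apply: leq_sum => i _; rewrite leqNgt none.
  by have := none k; rewrite -leqNgt; move: neq; lia.
- have : (\sum_(i < m | i != k) class_size Z i <= \sum_(i < m | i != k) (n %/ m))%N.
    by apply: leq_sum => i _; rewrite leqNgt none.
  by have := none k; rewrite -leqNgt; move: neq; lia.
Qed.

(* A single mover enlarges the class it joins. *)
Lemma single_mover (Z Z' : 'M[bool]_(n, m)) :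
  clustering Z -> clustering Z' -> (#|movers Z Z'| <= 1)%N ->
  (forall k, class_size Z k = class_size Z' k) -> Z = Z'.
Proof.
move=> clZ clZ' mov1 sizes; apply/row_matrixP => i; apply/eqP; apply: contraT => neq.
have only j : j != i -> row j Z = row j Z'.
  move=> ji; apply/eqP; apply: contraT => neqj; move: mov1.
  by rewrite (cardsD1 i) (cardsD1 j) !inE ji neq neqj.
suff : row i Z = row i Z' by move/eqP: neq.
apply/rowP => k; rewrite !mxE; have := sizes k.
rewrite !class_sizeE (bigD1 i) //= [RHS](bigD1 i) //=.
rewrite (eq_bigr (fun j => nat_of_bool (Z' j k))); last first.
  by move=> j /only /rowP/(_ k); rewrite !mxE => ->.
by move/addIn; case: (Z i k); case: (Z' i k).
Qed.

End Labelings.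

(** * A reference labeling with nearly equal classes *)

Section BaseLabeling.
Context {n m : nat} (m0 : (0 < m)%N).

Definition base_nat (i : nat) : nat :=
  (if i < n %/ m * m then i %% m else (i - n %/ m * m).+1)%N.

Lemma base_nat_lt (i : 'I_n) : (base_nat i < m)%N.
Proof.
rewrite /base_nat; case: (ltnP i (n %/ m * m)) => ?; first exact: ltn_pmod.
have := ltn_ord i; have := ltn_pmod n m0; have := divn_eq n m; lia.
Qed.

(* Full rows i = j * m + k, j < n / m, get label k; the remaining n mod m nodes
   enlarge the classes 1, .., n mod m, so that class 0 can always receive a
   node, and class 1 can give one up as soon as the sizes are not all equal. *)
Definition base (i : 'I_n) : 'I_m := Ordinal (base_nat_lt i).

Lemma sum_modn (q : nat) (F : nat -> nat) :
  (\sum_(0 <= i < q * m) F (i %% m) = q * \sum_(0 <= c < m) F c)%N.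
Proof.
elim: q => [|q IH]; first by rewrite big_nil.
rewrite mulSn (@big_cat_nat _ _ _ m) ?leq_addr //= mulSn; congr addn.
  by apply: eq_big_nat => i /andP[_ im]; rewrite modn_small.
rewrite -IH -{1}[m]add0n big_addn addKn; apply: eq_bigr => i _.
by rewrite modnDr.
Qed.

Lemma card_base (k : 'I_m) :
  #|[pred i | base i == k]| = (n %/ m + (0 < k <= n %% m))%N.
Proof.
rewrite -sum1_card big_mkcond /=.
transitivity (\sum_(i < n) (base_nat i == k))%N.
  by apply: eq_bigr => i _; rewrite inE; case: eqP => [<-|neq]; [rewrite eqxx|
    case: eqP => // e; case: neq; apply: val_inj].
rewrite -(big_mkord xpredT (fun i => nat_of_bool (base_nat i == k))).
rewrite (@big_cat_nat _ _ _ (n %/ m * m)) //=; last exact: leq_trunc_div.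
congr addn.
  rewrite -[RHS]muln1.
  transitivity (\sum_(0 <= i < n %/ m * m) (i %% m == k))%N.
    by apply: eq_big_nat => i /andP[_ lt]; rewrite /base_nat lt.
  rewrite (sum_modn _ (fun c => nat_of_bool (c == k))) big_mkord; congr muln.
  by rewrite (bigD1 k) //= eqxx big1 // => i /negbTE; rewrite -val_eqE => ->.
rewrite -{1}[(n %/ m * m)%N]add0n big_addn.
rewrite (_ : n - n %/ m * m = n %% m)%N; last first.
  by rewrite {1}(divn_eq n m) addKn.
transitivity (\sum_(0 <= i < n %% m) (i.+1 == k))%N.
  apply: eq_bigr => i _.
  by rewrite /base_nat ltnNge leq_addl /= addnK.
case: (val k) => [|k'] /=; first by rewrite big1.
elim: (n %% m)%N => [|r IH]; first by rewrite big_nil.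
by rewrite big_nat_recr //= IH eqSS; lia.
Qed.

Lemma base_row r c (i : 'I_n) : (r < n %/ m)%N -> (c < m)%N ->
  i = (r * m + c)%N :> nat -> base i = c :> nat.
Proof.
move=> rq cm e; rewrite /= /base_nat e ifT ?modnMDl ?modn_small //.
by have := leq_mul rq (leqnn m); rewrite mulSn; lia.
Qed.

Lemma divn_row r c : (c < m)%N -> ((r * m + c) %/ m = r)%N.
Proof. by move=> cm; rewrite divnMDl // divn_small ?addn0. Qed.

Lemma sum_rows_le (R : realType) (lo len K : nat) (psi : 'I_len -> 'I_K -> R)
    (f : 'I_n -> R) :
  (lo + len <= n %/ m)%N -> (K <= m)%N -> (forall i, 0 <= f i) ->
  (forall (r : 'I_len) (c : 'I_K) (i : 'I_n), i = ((lo + r) * m + c)%N :> nat -> psi r c <= f i) ->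
  \sum_r \sum_c psi r c <= \sum_i f i.
Proof.
move=> lole Km f0 psif.
have node_lt (v : 'I_len * 'I_K) : ((lo + v.1) * m + v.2 < n)%N.
  have := ltn_ord v.1; have := ltn_ord v.2 => ? ?.
  have : ((lo + v.1).+1 * m <= n %/ m * m)%N by rewrite leq_mul2r; lia.
  by have := leq_trunc_div n m; lia.
pose node v := Ordinal (node_lt v).
have node_inj : injective node.
  move=> [r c] [r' c'] /(congr1 val) /= e.
  have cm : (c < m)%N by exact: leq_trans Km.
  have cm' : (c' < m)%N by exact: leq_trans Km.
  have := congr1 (modn^~ m) e; rewrite /= !modnMDl !modn_small // => /val_inj ->.
  have := congr1 (divn^~ m) e; rewrite /= !divn_row //.
  by move=> /addnI/val_inj ->.
rewrite pair_bigA /=; apply: le_trans (ler_sum_inj node_inj f0).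
by apply: ler_sum => v _; apply: psif.
Qed.

End BaseLabeling.

(** * Admissible class sizes *)

Section Balance.
Context {R : realType} {m n L n0 : nat} {al1 al2 : R}.
Context (m0 : (0 < m)%N) (al11 : al1 <= 1) (al21 : 1 <= al2).

Definition balanced (s : nat) : bool :=
  al1 * n%:R / m%:R <= s%:R <= al2 * n%:R / m%:R.

(** Integrality of class sizes could make [Zbal] empty. Given one member, the pigeonhole principle
    yields a class at most n / m and, if m does not divide n, one above it; the bounds on these
    transfer to the sizes of [base]. *)
Lemma balanced_quotient (C : 'I_L -> 'M[bool]_(n, m)) (l : 'I_L) :
  Zbal m n L n0 al1 al2 C ->
  balanced (n %/ m) /\ ((0 < n %% m)%N -> balanced (n %/ m).+1).
Proof.
have mR : 0 < m%:R :> R by rewrite ltr0n.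
case=> clC _ balC; split.
  have [k lek] := class_le_quotient m0 (clC l); have /andP[lo _] := balC l k.
  apply/andP; split; first by rewrite (le_trans lo) // ler_nat.
  rewrite ler_pdivlMr // -natrM; apply: (@le_trans _ _ n%:R).
    by rewrite ler_nat leq_trunc_div.
  by rewrite ler_peMl.
move=> r0; have [k ltk] := class_gt_quotient r0 (clC l); have /andP[_ hi] := balC l k.
apply/andP; split; last by rewrite (le_trans _ hi) // ler_nat.
rewrite ler_pdivrMr // -natrM; apply: (@le_trans _ _ n%:R).
  by rewrite ler_piMl.
by rewrite ler_nat ltnW // ltn_ceil.
Qed.

Lemma base_balanced :
  balanced (n %/ m) -> ((0 < n %% m)%N -> balanced (n %/ m).+1) ->
  forall k, balanced #|[pred i : 'I_n | base m0 i == k]|.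
Proof.
move=> balq balr k; rewrite card_base.
case: (boolP (0 < k <= n %% m)%N) => [/andP[k0 kr]|_]; last by rewrite addn0.
by rewrite addn1; apply: balr; exact: leq_trans kr.
Qed.

Lemma adjacent_const (C : 'I_L -> 'M[bool]_(n, m)) :
  (forall l l' : 'I_L, l' = l.+1 :> nat -> C l = C l') -> forall l l', C l = C l'.
Proof.
move=> adj.
suff aux d : forall l l' : 'I_L, (l' = l + d :> nat)%N -> C l = C l'.
  move=> l l'; case: (leqP l l') => ll; first by apply: (aux (l' - l)%N); lia.
  by apply/esym/(aux (l - l')%N); lia.
elim: d => [|d IH] l l' e; first by congr C; apply: val_inj; rewrite /= e addn0.
have lt : (l + d < L)%N by have := ltn_ord l'; lia.
by rewrite (IH l (Ordinal lt)) //; apply: adj => /=; lia.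
Qed.

(** With one move per step, a sequence whose classes always have size n / m cannot change, by
    [single_mover]. A nonconstant one therefore has, at some time, a class below n / m and a class
    above it, so that both neighbouring sizes are admissible. *)
Lemma balanced_neighbours (C : 'I_L -> 'M[bool]_(n, m)) (l l' : 'I_L) :
  Zbal m n L 1 al1 al2 C -> C l <> C l' -> (m %| n)%N ->
  balanced (n %/ m).-1 /\ balanced (n %/ m).+1.
Proof.
case=> clC movC balC neq mn.
have mR : 0 < m%:R :> R by rewrite ltr0n.
have nq : (n %/ m)%:R = n%:R / m%:R :> R.
  by rewrite -[in RHS](divnK mn) natrM mulfK // gt_eqF.
have nm0 : 0 <= n%:R / m%:R :> R by rewrite divr_ge0.
have : exists l1 k, class_size (C l1) k != (n %/ m)%N.
  apply: contra_notP neq => none; apply: adjacent_const => {}l {}l' ll'.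
  apply: single_mover => // [|k]; first exact: movC.
  have all1 l1 : class_size (C l1) k = (n %/ m)%N.
    by apply/eqP; apply: contra_notT none => ?; exists l1, k.
  by rewrite !all1.
move=> [l1 [k neqk]].
have [[k1 lt1] [k2 lt2]] := unequal_classes mn (clC l1) neqk.
have /andP[lo1 _] := balC l1 k1; have /andP[_ hi2] := balC l1 k2.
split; apply/andP; split.
- by rewrite (le_trans lo1) // ler_nat; lia.
- apply: (@le_trans _ _ (n %/ m)%:R); first by rewrite ler_nat leq_pred.
  by rewrite nq -mulrA ler_peMl.
- apply: (@le_trans _ _ (n %/ m)%:R); last by rewrite ler_nat.
  by rewrite nq -mulrA ler_piMl.
- by rewrite (le_trans _ hi2) // ler_nat.
Qed.

End Balance.

(** * Hadamard connectivity *)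

Section HadamardCode.

(* The bits of the 2^a x 2^a Sylvester-Hadamard matrix. *)
Fixpoint hbit (a i j : nat) : bool :=
  if a is a'.+1 then hbit a' i./2 j./2 (+) (odd i && odd j) else false.

Lemma hbitC a i j : hbit a i j = hbit a j i.
Proof. by elim: a i j => //= a IH i j; rewrite IH andbC. Qed.

Lemma sum_double (N : nat) (F : nat -> nat) :
  (\sum_(0 <= j < N.*2) F j = \sum_(0 <= j < N) (F j.*2 + F j.*2.+1))%N.
Proof.
elim: N => [|N IH]; first by rewrite !big_nil.
by rewrite doubleS !big_nat_recr //= IH addnA.
Qed.

(** Orthogonality of distinct rows of a Hadamard matrix. Columns 2j and 2j + 1 are paired: if the
    last bits of the row indices differ, exactly one column of each pair separates the rows;
    otherwise each pair repeats a column of the smaller code. *)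
Lemma hbit_dist a i i' : (i < 2 ^ a)%N -> (i' < 2 ^ a)%N -> i != i' ->
  ((\sum_(0 <= j < 2 ^ a) (hbit a i j != hbit a i' j)).*2 = 2 ^ a)%N.
Proof.
elim: a i i' => [|a IH] i i'; first by rewrite expn0; case: i; case: i'.
rewrite expnS mul2n => ia ia' neq.
rewrite sum_double /=; under eq_bigr => j _ do
  rewrite doubleK uphalf_double odd_double !andbF !addbF !andbT.
have [e|neq2] := eqVneq i./2 i'./2.
  have oddneq : odd i != odd i'.
    by apply: contra neq => /eqP e'; rewrite -(odd_double_half i) e e' odd_double_half.
  congr double; rewrite e; under eq_bigr => j _.
    rewrite (_ : _ + _ = 1)%N; last first.
      by move: oddneq; case: (odd i); case: (odd i'); case: (hbit _ _ _).
    over.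
  by rewrite sum_nat_const_nat subn0 muln1.
have i2 : (i./2 < 2 ^ a)%N by lia.
have i2' : (i'./2 < 2 ^ a)%N by lia.
have {}IH := IH _ _ i2 i2' neq2.
have [oe|on] := eqVneq (odd i) (odd i').
  congr double; rewrite -[RHS]IH -mul2n big_distrr /=; apply: eq_bigr => j _.
  by rewrite oe; case: (odd i'); case: (hbit a _ _); case: (hbit a _ _).
congr double; rewrite (eq_bigr (fun=> 1%N)) ?sum_nat_const_nat ?subn0 ?muln1 // => j _.
by move: on; case: (odd i); case: (odd i'); case: (hbit a _ _); case: (hbit a _ _).
Qed.

End HadamardCode.

(** * Probability tensors built from a Hadamard pattern *)

Section Model.
Context {R : realType} {n m L : nat}.
Context (m2 : (2 <= m)%N) (nm : (2 * m <= n)%N).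
Implicit Types (z : 'I_n -> 'I_m) (Z : 'I_L -> 'I_n -> 'I_m).

Definition code_len : nat := trunc_log 2 m.
(** The order of the Hadamard matrix: the largest power of two not exceeding [m]. *)
Definition code_size : nat := 2 ^ code_len.
(** Only half of the full rows may be relabelled; the others keep their known labels and serve as a
    reference that makes wrong labels visible. *)
Definition mobile_rows : nat := n %/ m %/ 2.

Lemma code_size_le : (code_size <= m)%N.
Proof. by apply: trunc_logP => //; exact: ltnW. Qed.

Lemma lt_code_size : (m < 2 * code_size)%N.
Proof. by rewrite /code_size -expnS; exact: trunc_log_ltn. Qed.

Lemma code_size_ge2 : (2 <= code_size)%N.
Proof.
rewrite /code_size -[X in (X <= _)%N](expn1 2) leq_exp2l //.
by rewrite /code_len trunc_log_max.
Qed.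

Lemma quotient_ge2 : (2 <= n %/ m)%N.
Proof. by rewrite leq_divRL //; lia. Qed.

Definition pattern (k k' : nat) : bool :=
  [&& (k < code_size)%N, (k' < code_size)%N & hbit code_len k k'].

Lemma patternC k k' : pattern k k' = pattern k' k.
Proof. by rewrite /pattern hbitC andbCA. Qed.

Definition pattern_conn (del : R) : tensor R m L :=
  [ffun a : 'I_m * 'I_m * 'I_L => 2^-1 + del * (pattern a.1.1 a.1.2)%:R].

Definition pattern_tensor (del : R) Z : tensor R n L :=
  [ffun a : 'I_n * 'I_n * 'I_L => if a.1.1 == a.1.2 then 0
             else 2^-1 + del * (pattern (Z a.2 a.1.1) (Z a.2 a.1.2))%:R].

Definition mobile (i : 'I_n) : bool :=
  (i %/ m < mobile_rows)%N && (i %% m < code_size)%N.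

Lemma pattern_tensor_dsbm del Z :
  dsbm_tensor (pattern_conn del) (fun l => label_mx (Z l)) (pattern_tensor del Z).
Proof.
split=> [i l|i j l k k' ij]; first by rewrite ffunE eqxx.
by rewrite !mxE !ffunE /= (negbTE ij) => /eqP -> /eqP ->.
Qed.

Lemma pattern_tensor_bounds del Z a : 0 <= del <= 4^-1 -> above_diag a ->
  4^-1 <= pattern_tensor del Z a <= 3 / 4.
Proof.
move=> /andP[? ?] ua; rewrite ffunE ifN; last first.
  by apply: contraL ua => /eqP; rewrite /above_diag => ->; rewrite ltnn.
by case: (pattern _ _) => /=; apply/andP; split; lra.
Qed.

(** The rows of Q are multiples of the all-ones vector, which [H] sends to a multiple of e_1; D thus
    lives at frequency 0 only, and there the weight vanishes. *)
Lemma time_constant_smooth (H : 'M[R]_L) (nu0 K0 : R) (G : tensor R m L) :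
  0 < nu0 -> 0 <= K0 -> maps_ones_to_e1 H -> connectivity G ->
  (forall k k' l l', G (k, k', l) = G (k', k, l')) ->
  smooth_class H nu0 K0 G.
Proof.
move=> nu00 K00 Hones connG constG; split=> // D k.
rewrite big1 // => l _; case: (posnP l) => l0.
  by rewrite l0 powR0 ?mul0r // gt_eqF //; lra.
suff -> : D k l = 0 by rewrite expr0n /= mulr0.
rewrite /D mxE; set p := val (enum_val k).
have /colP/(_ l) := Hones; rewrite !mxE (gtn_eqF l0) mulr0.
under eq_bigr do rewrite !mxE mulr1.
move=> Hl; under eq_bigr do rewrite !mxE /= (constG _ _ _ l) mulrC.
by rewrite -mulr_suml Hl mul0r.
Qed.

Lemma pattern_conn_smooth (H : 'M[R]_L) (nu0 K0 del : R) :
  0 < nu0 -> 0 <= K0 -> maps_ones_to_e1 H -> 0 <= del <= 4^-1 ->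
  smooth_class H nu0 K0 (pattern_conn del).
Proof.
move=> nu00 K00 Hones /andP[? ?]; apply: time_constant_smooth => //.
  split=> [a|k k' l]; last by rewrite !ffunE /= patternC.
  by rewrite ffunE; case: (pattern _ _) => /=; apply/andP; split; lra.
by move=> k k' l l'; rewrite !ffunE /= patternC.
Qed.

Definition hdist (z z' : 'I_n -> 'I_m) : nat := #|[pred i | z i != z' i]|.

Lemma hdistE z z' : (hdist z z' = \sum_(i < n) (z i != z' i))%N.
Proof. by rewrite /hdist -sum1_card big_mkcond. Qed.

Lemma sqnormE (X : tensor R n L) :
  sqnorm X = \sum_(l < L) \sum_(i < n) \sum_(j < n) X (i, j, l) ^+ 2.
Proof.
rewrite /sqnorm (eq_bigr (fun a => X (a.1, a.2) ^+ 2)); last by case.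
rewrite -(pair_bigA _ (fun e l => X (e, l) ^+ 2)) /= exchange_big /=.
apply: eq_bigr => l _.
rewrite (eq_bigr (fun e => X (e.1, e.2, l) ^+ 2)); last by case.
by rewrite -(pair_bigA _ (fun i j => X (i, j, l) ^+ 2)).
Qed.

(** An entry changes only if one of its two nodes is relabelled, and then by at most [del]; a
    relabelled node meets at most 2 n entries per time. *)
Lemma pattern_tensor_dist_le (del : R) Z Z' :
  sqnorm (pattern_tensor del Z - pattern_tensor del Z') <=
  del ^+ 2 * (2 * n%:R * \sum_(l < L) (hdist (Z l) (Z' l))%:R).
Proof.
rewrite sqnormE !mulr_sumr; apply: ler_sum => l _.
apply: (@le_trans _ _ (\sum_(i < n) \sum_(j < n)
    del ^+ 2 * ((Z l i != Z' l i)%:R + (Z l j != Z' l j)%:R))).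
  apply: ler_sum => i _; apply: ler_sum => j _; rewrite !ffunE /=.
  case: eqP => _.
    by rewrite subr0 expr0n /= mulr_ge0 ?sqr_ge0 // addr_ge0 // ler0n.
  have [->|_] := eqVneq (Z l i) (Z' l i); last first.
    case: (pattern _ _); case: (pattern _ _); case: (_ != _) => /=;
    have := sqr_ge0 del; lra.
  have [->|_] := eqVneq (Z l j) (Z' l j); first by rewrite subrr expr0n /= !addr0 mulr0.
  by case: (pattern _ _); case: (pattern _ _) => /=; have := sqr_ge0 del; lra.
under eq_bigr do rewrite -mulr_sumr.
rewrite -mulr_sumr ler_wpM2l ?sqr_ge0 // hdistE natr_sum.
set s := \sum_(i < n) (Z l i != Z' l i)%:R.
rewrite (eq_bigr (fun i => n%:R * (Z l i != Z' l i)%:R + s)); last first.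
  by move=> i _; rewrite big_split /= sumr_const card_ord mulr_natl.
by rewrite big_split /= -mulr_sumr sumr_const card_ord -/s -(mulr_natl s); lra.
Qed.

Definition code_labeling z :=
  (forall i, ~~ mobile i -> z i = base (ltnW m2) i) /\
  (forall i, mobile i -> (z i < code_size)%N).

Lemma base_mobile (i : 'I_n) : mobile i -> (base (ltnW m2) i < code_size)%N.
Proof.
move=> /andP[ip ic]; rewrite (base_row (ltnW m2) (r := i %/ m) (c := i %% m)) -?divn_eq ?ltn_mod //.
  by rewrite (leq_trans ip) // /mobile_rows leq_div.
exact: ltnW.
Qed.

Lemma immobile_row r c (i : 'I_n) : (c < m)%N ->
  i = ((mobile_rows + r) * m + c)%N :> nat -> ~~ mobile i.
Proof.
move=> cm e; rewrite /mobile e divnMDl ?(leq_ltn_trans _ cm) // divn_small //.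
by rewrite negb_and -leqNgt addn0 leq_addr.
Qed.

(** Rounding losses: n lies below n / m + 1 rows, [mobile_rows] is at least a third of n / m because
    n / m >= 2, and [code_size] exceeds m / 2. *)
Lemma mobile_count : (n <= 9 * (mobile_rows * code_size))%N.
Proof.
have q2 := quotient_ge2.
have qp : (n %/ m <= 3 * mobile_rows)%N by rewrite /mobile_rows; lia.
have nq : (n <= (n %/ m).+1 * m)%N by rewrite ltnW // ltn_ceil // ltnW.
have := lt_code_size; nia.
Qed.

Lemma immobile_count : (n <= 8 * ((n %/ m - mobile_rows) * code_size))%N.
Proof.
have q2 := quotient_ge2.
have qp : (n %/ m <= 2 * (n %/ m - mobile_rows))%N by rewrite /mobile_rows; lia.
have nq : (n <= (n %/ m).+1 * m)%N by rewrite ltnW // ltn_ceil // ltnW.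
have := lt_code_size; nia.
Qed.

(* Only the pairs formed by a misclassified (hence mobile) node and an immobile
   one are used: the labels of the latter reveal a whole row of the code. *)
Lemma pattern_tensor_dist_ge (del : R) Z Z' :
  (forall l, code_labeling (Z l)) -> (forall l, code_labeling (Z' l)) ->
  del ^+ 2 * (n%:R / 16 * \sum_(l < L) (hdist (Z l) (Z' l))%:R) <=
  sqnorm (pattern_tensor del Z - pattern_tensor del Z').
Proof.
move=> goodZ goodZ'.
rewrite sqnormE !mulr_sumr; apply: ler_sum => l _.
have [baseZ codeZ] := goodZ l; have [baseZ' codeZ'] := goodZ' l.
rewrite hdistE natr_sum !mulr_sumr; apply: ler_sum => i _.
have [_|neq] /= := eqVneq (Z l i) (Z' l i).
  by rewrite !mulr0 sumr_ge0 // => j _; exact: sqr_ge0.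
rewrite mulr1.
have mob : mobile i by apply: contraT => nmob; move: neq; rewrite baseZ ?baseZ' ?eqxx.
pose b (c : nat) := hbit code_len (Z l i) c != hbit code_len (Z' l i) c.
apply: (@le_trans _ _ (\sum_(r < n %/ m - mobile_rows) \sum_(c < code_size)
    del ^+ 2 * (b c)%:R)).
  under eq_bigr do rewrite -mulr_sumr.
  rewrite sumr_const card_ord -[leRHS]mulr_natl [leRHS]mulrCA ler_wpM2l ?sqr_ge0 //.
  rewrite -natr_sum -natrM ler_pdivrMr // -natrM ler_nat.
  (* Half of the code columns separate the two labels, and [immobile_count] loses a factor 8, whence
     the 16. *)
  have := hbit_dist (codeZ i mob) (codeZ' i mob) neq.
  rewrite big_mkord -/code_size /b; set S := (\sum_(c < code_size) _)%N => half.
  have := immobile_count; rewrite -half -muln2.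
  by move: (n %/ m - mobile_rows)%N (S) => x y; lia.
apply: (@sum_rows_le _ _ (ltnW m2) _ mobile_rows _ _ (fun _ c => del ^+ 2 * (b c)%:R)) =>
  [|||r c j e].
- by have := leq_div (n %/ m) 2; rewrite -/mobile_rows; lia.
- exact: code_size_le.
- by move=> j; exact: sqr_ge0.
have cm : (c < m)%N by exact: leq_trans (ltn_ord c) code_size_le.
have nmob : ~~ mobile j by exact: immobile_row e.
have ij : i != j by apply: contraTneq mob => ->.
have rq : (mobile_rows + r < n %/ m)%N by rewrite -ltn_subRL.
rewrite !ffunE /= (negbTE ij) (baseZ j nmob) (baseZ' j nmob) /pattern.
rewrite !(base_row _ rq cm e) codeZ // codeZ' //=.
rewrite ltn_ord /b /=; case: (hbit _ _ _); case: (hbit _ _ _) => /=; lra.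
Qed.

End Model.

(** * Clustering hypotheses *)

Section ClusteringTesting.
Context {R : realType} {n m L : nat}.
Context (m2 : (2 <= m)%N) (nm : (2 * m <= n)%N).
Implicit Types z : 'I_n -> 'I_m.

Definition log_moves (h : nat) : R := ln (m%:R * n%:R * expR 1 / h%:R).

Lemma log_moves_ge1 h : (0 < h <= n)%N -> 1 <= log_moves h.
Proof.
move=> /andP[h0 hn]; have hR : 0 < h%:R :> R by rewrite ltr0n.
have nR : h%:R <= n%:R :> R by rewrite ler_nat.
have mR : 1 <= m%:R :> R by rewrite ler1n ltnW.
have e0 := expR_gt0 (1 : R).
rewrite -[leLHS](expRK 1) /log_moves ler_ln ?posrE //; last first.
  by rewrite divr_gt0 // !mulr_gt0 //; lra.
by rewrite ler_pdivlMr // mulrC ler_pM2r //; nra.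
Qed.

(** Keeps the amplitude of the Hadamard connectivity below 1/4 in [clustering_testing]. Since m <= n
    <= exp (n - 1), the argument of the logarithm is at most exp (2 n - 1). *)
Lemma log_moves_le h : (0 < h <= n)%N -> log_moves h <= 2 * n%:R.
Proof.
move=> /andP[h0 hn]; have hR : 1 <= h%:R :> R by rewrite ler1n.
have mR : 1 <= m%:R :> R by rewrite ler1n ltnW.
have mnR : m%:R <= n%:R :> R by rewrite ler_nat; lia.
have e0 := expR_gt0 (1 : R).
rewrite -[leRHS]expRK /log_moves ler_ln ?posrE ?expR_gt0 //; last first.
  by rewrite divr_gt0 // ?mulr_gt0 //; lra.
pose x : R := n%:R - 1.
have en : n%:R <= expR x by have := expR_ge1Dx x; rewrite /x; lra.
rewrite (_ : 2 * n%:R = x + x + 1 + 1 :> R); last by rewrite /x; ring.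
clearbody x.
rewrite ler_pdivrMr; last by lra.
rewrite !expRD.
apply: (@le_trans _ _ (expR x * expR x * expR 1)).
  by rewrite ler_pM2r // ler_pM //; lra.
have e1 : 1 <= expR 1 :> R by rewrite -[leLHS]expR0 ler_expR.
set y := expR x * expR x * expR 1; have y0 : 0 <= y by rewrite !mulr_ge0 ?expR_ge0.
have eh : 1 <= expR 1 * h%:R :> R by nra.
by have := ler_wpM2l y0 eh; lra.
Qed.

(** Enlarging the family to all labelings makes the exponential moment of the Hamming distance a
    product over the nodes, with factors 1 + (m - 1) exp (-t). *)
Lemma sum_labelings_le (A : finType) (zz : A -> 'I_n -> 'I_m) (t : R) :
  (forall a b, zz a =1 zz b -> a = b) ->
  forall z, \sum_b expR (- t * (hdist z (zz b))%:R) <=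
            expR (n%:R * (m%:R * expR (- t))).
Proof.
move=> zz_inj z.
apply: (@le_trans _ _ (\sum_(y : {ffun 'I_n -> 'I_m}) expR (- t * (hdist z y)%:R))).
  pose F b : {ffun 'I_n -> 'I_m} := [ffun i => zz b i].
  have Finj : injective F.
    by move=> a b /ffunP e; apply: zz_inj => i; have := e i; rewrite !ffunE.
  rewrite (eq_bigr (fun b => expR (- t * (hdist z (F b))%:R))); last first.
    move=> b _; congr (expR (_ * _%:R)); rewrite !hdistE.
    by apply: eq_bigr => i _; rewrite ffunE.
  apply: (@ler_sum_inj _ _ _ F (fun y => expR (- t * (hdist z y)%:R))); last first.
    by move=> y; exact: expR_ge0.
  exact: Finj.
rewrite (eq_bigr (fun y : {ffun 'I_n -> 'I_m} =>
    \prod_i expR (- t * (z i != y i)%:R))); last first.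
  by move=> y _; rewrite -expR_sum -mulr_sumr -natr_sum -hdistE.
rewrite -(bigA_distr_bigA (fun i k => expR (- t * (z i != k)%:R))) expRM_natl.
rewrite -[in leRHS](card_ord n) -prodr_const; apply: ler_prod => i _.
rewrite sumr_ge0 /=; last by move=> k _; exact: expR_ge0.
apply: le_trans (expR_ge1Dx _).
rewrite (bigD1 (z i)) //= eqxx mulr0 expR0 lerD2l.
rewrite (eq_bigr (fun=> expR (- t))); last by move=> k; rewrite eq_sym => ->; rewrite mulr1.
rewrite sumr_const -[leLHS]mulr_natl ler_wpM2r ?expR_ge0 // ler_nat.
by rewrite -[leqRHS]card_ord max_card.
Qed.

Context (S : finType) (tau : 'I_L -> option S) (W : nat).
Hypothesis tauW : forall s, #|[pred l | tau l == Some s]| = W.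

Lemma sum_layers (F : option S -> R) : F None = 0 ->
  \sum_l F (tau l) = W%:R * \sum_s F (Some s).
Proof.
move=> F0; transitivity (\sum_l \sum_(s | tau l == Some s) F (Some s)).
  apply: eq_bigr => l _; case: (tau l) => [s|]; last by rewrite big_pred0.
  by rewrite (big_pred1 s).
rewrite (exchange_big_dep xpredT) //= mulr_sumr; apply: eq_bigr => s _.
by rewrite sumr_const tauW mulr_natl.
Qed.

(** The independent labelings are indexed by [S]; [tau] tells which one is in force at each time,
    and each is in force at [W] times. *)
Definition layers (A : Type) (zz : A -> 'I_n -> 'I_m) (f : S -> A) (l : 'I_L) :=
  if tau l is Some s then zz (f s) else base (ltnW m2).

(** Covers both clustering terms: a single layer with W = L in the static case, many layers with W =
    1 in the dynamic one. The squared amplitude is inversely proportional to [W], so [W] cancels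
    from the bound. *)
Lemma clustering_testing (A : finType) (zz : A -> 'I_n -> 'I_m) (h : nat) (c0 : R)
    (GG : set (tensor R m L)) (CC : set ('I_L -> 'M[bool]_(n, m)))
    (hatLam : tensor bool n L -> tensor R n L) :
  (0 < W)%N -> (0 < #|S|)%N -> (0 < h <= n)%N -> 0 < c0 <= 1 ->
  (forall a, code_labeling m2 (zz a)) -> (forall a b, zz a =1 zz b -> a = b) ->
  (forall a, hdist (zz a) (base (ltnW m2)) <= h)%N ->
  (1 < #|A|)%N -> c0 * (h%:R * log_moves h) <= ln #|A|%:R ->
  (forall f : S -> A, CC (fun l => label_mx (layers zz f l))) ->
  (forall del, 0 <= del <= 4^-1 -> GG (pattern_conn del)) ->
  exists2 Lam, dsbm_class GG CC Lam & 4^-1 <= Pr Lam (fun B =>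
    c0 ^+ 2 / (16 * 216 * 72 * (1 + ln (18 / c0))) * (#|S|%:R * (h%:R * log_moves h))
      <= sqnorm (hatLam B - Lam)).
Proof.
move=> W0 S0 hn /andP[c00 c01] goodz zz_inj zzh A1 lnA CCf GGdel.
have /andP[h0 hn'] := hn.
have [l1 ln2] := (log_moves_ge1 hn, log_moves_le hn).
set l := log_moves h in lnA l1 ln2 *.
have hR : 0 < h%:R :> R by rewrite ltr0n.
have WR : 1 <= W%:R :> R by rewrite ler1n.
have SR : 1 <= #|S|%:R :> R by rewrite ler1n.
have nR : 1 <= n%:R :> R by rewrite ler1n; lia.
have mR : 1 <= m%:R :> R by rewrite ler1n ltnW.
(* The squared amplitude that exhausts the chi-square budget: 6 * d2 * 2 n W |S| h = |S| c0 h l /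
   18, with 216 = 12 * 18. *)
pose d2 : R := c0 * l / (216 * W%:R * n%:R).
have Wn0 : 0 < 216 * W%:R * n%:R :> R by rewrite !mulr_gt0 //; lra.
have d20 : 0 < d2 by rewrite divr_gt0 // mulr_gt0 //; lra.
pose del := Num.sqrt d2.
have delE : del ^+ 2 = d2 by rewrite sqr_sqrtr // ltW.
have del4 : 0 <= del <= 4^-1.
  rewrite sqrtr_ge0 /= -[leRHS](@ger0_norm R) // -sqrtr_sqr.
  apply: ler_wsqrtr; rewrite ler_pdivrMr //.
  by have : 0 <= n%:R * (W%:R - 1) :> R; [rewrite mulr_ge0 //; lra|nra].
have upper0 f a : above_diag a -> 4^-1 <= pattern_tensor del f a <= 3 / 4.
  exact: pattern_tensor_bounds.
have prob Z : prob_tensor (pattern_tensor del Z).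
  by move=> a /(pattern_tensor_bounds Z del4)/andP[? ?]; apply/andP; split; lra.
(* Chosen so that n m exp (-t) = c0 h / 18, which is at most ln |A| / 18 because l >= 1. *)
pose t := ln (18 * (n%:R * m%:R) / (c0 * h%:R)).
have nmh : 1 <= n%:R * m%:R / h%:R :> R.
  by rewrite ler_pdivlMr // mul1r -natrM ler_nat (leq_trans hn') // leq_pmulr // ltnW.
have c18 : 1 < 18 / c0 by rewrite ltr_pdivlMr //; lra.
have tE : t = ln (n%:R * m%:R / h%:R) + ln (18 / c0).
  rewrite -lnM ?posrE //; [|by lra..].
  by congr ln; field; rewrite !gt_eqF.
have lnc : 0 < ln (18 / c0) by rewrite ln_gt0.
have t0 : 0 < t by rewrite tE ltr_wpDl // ln_ge0.
(* The testing bound is divided by [t]; the factor [l] of [d2] makes up for it at the cost of this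
   constant. *)
have tl : t <= (1 + ln (18 / c0)) * l.
  have : ln (n%:R * m%:R / h%:R) <= l.
    rewrite ler_ln ?posrE //; [|by lra|].
      rewrite (mulrC m%:R) ler_pM2r ?invr_gt0 // ler_peMr //.
      by rewrite -[leLHS]expR0 ler_expR.
    by rewrite divr_gt0 // !mulr_gt0 ?expR_gt0 //; lra.
  have : 0 <= ln (18 / c0) * (l - 1) by rewrite mulr_ge0 //; lra.
  by rewrite tE; lra.
pose gam := d2 * (n%:R / 16) * W%:R.
have gam0 : 0 < gam by apply: mulr_gt0; [apply: mulr_gt0 => //; apply: divr_gt0|]; lra.
have sumd (f g : S -> A) :
    \sum_l (hdist (layers zz f l) (layers zz g l))%:R =
    W%:R * \sum_s (hdist (zz (f s)) (zz (g s)))%:R :> R.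
  pose F o : R := (if o is Some s then hdist (zz (f s)) (zz (g s)) else 0%N)%:R.
  rewrite -(sum_layers (F := F)) //; apply: eq_bigr => l' _.
  rewrite /layers /F; case: (tau l') => //; congr _%:R.
  by rewrite /hdist; apply: eq_card0 => i; rewrite inE eqxx.
have sumd0 (f : S -> A) :
    \sum_l (hdist (layers zz f l) (base (ltnW m2)))%:R <= W%:R * (#|S|%:R * h%:R) :> R.
  pose F o : R := (if o is Some s then hdist (zz (f s)) (base (ltnW m2)) else 0%N)%:R.
  rewrite (eq_bigr (fun l => F (tau l))); last first.
    move=> l' _; rewrite /layers /F; case: (tau l') => //; congr _%:R.
    by rewrite /hdist; apply: eq_card0 => i; rewrite inE eqxx.
  rewrite sum_layers // ler_wpM2l // -sum1_card natr_sum mulr_suml.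
  by apply: ler_sum => s _; rewrite mul1r ler_nat.
have goodl f l' : code_labeling m2 (layers zz f l').
  rewrite /layers; case: (tau l') => [s|]; first exact: goodz.
  by split=> // i; exact: base_mobile.
have [] := @product_testing R n L S A (fun f => pattern_tensor del (layers zz f))
  (pattern_tensor del (fun=> base (ltnW m2)))
  (fun a b => (hdist (zz a) (zz b))%:R) t gam hatLam => // [a|f g|a|f|f].
- exact: pattern_tensor_bounds.
- apply: le_trans (pattern_tensor_dist_ge nm del (goodl f) (goodl g)).
  by rewrite sumd delE /gam -!mulrA.
- apply: le_trans (sum_labelings_le _ zz_inj _) _; rewrite ler_expR.
  rewrite expRN lnK ?posrE; last first.
    by rewrite divr_gt0 // !mulr_gt0 //; lra.
  rewrite (_ : _ * _ = c0 * h%:R / 18); last first.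
    by field; rewrite !gt_eqF //; lra.
  rewrite ler_pM2r ?invr_gt0 //; apply: le_trans lnA.
  by rewrite ler_pM2l // ler_peMr.
- have := pattern_tensor_dist_le del (layers zz f) (fun=> base (ltnW m2)).
  rewrite delE => /le_trans le2.
  apply: (@le_trans _ _ (6 * (d2 * (2 * n%:R * (W%:R * (#|S|%:R * h%:R)))))).
    rewrite ler_pM2l //; apply: le2.
    by rewrite ler_pM2l // ler_wpM2l // mulr_ge0.
  rewrite (_ : 6 * _ = #|S|%:R * (c0 * (h%:R * l)) / 18); last first.
    by rewrite /d2; field; rewrite !gt_eqF //; lra.
  by rewrite ler_pM2r ?invr_gt0 // ler_wpM2l.
- move=> large; exists (pattern_tensor del (layers zz f)).
    exists (pattern_conn del), (fun l => label_mx (layers zz f l)).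
    by split; [exact: GGdel|exact: CCf|exact: pattern_tensor_dsbm].
  apply: le_trans large _; apply: le_Pr => // B; apply: le_trans.
  apply: (@le_trans _ _ (gam * (#|S|%:R * (c0 * (h%:R * l))) / (72 * t))); last first.
    rewrite ler_pM2r ?invr_gt0 ?mulr_gt0 //; rewrite ler_pM2l // ler_wpM2l //.
  rewrite ler_pdivlMr ?mulr_gt0 //.
  rewrite (_ : gam * _ = c0 ^+ 2 / (16 * 216) * (#|S|%:R * (h%:R * l)) * l); last first.
    by rewrite /gam /d2; field; rewrite !gt_eqF //; lra.
  set c2 := 1 + ln (18 / c0) in tl *.
  have c20 : 0 < c2 by rewrite /c2; lra.
  rewrite (_ : _ * (72 * t) = c0 ^+ 2 / (16 * 216) * (#|S|%:R * (h%:R * l)) * (t / c2)).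
    rewrite ler_pM2l ?ler_pdivrMr 1?mulrC //.
    by rewrite !mulr_gt0 ?exprn_gt0 //; lra.
  by field; rewrite gt_eqF.
Qed.

End ClusteringTesting.

(** * Sparse permutations *)

Lemma fact_le_exp u : (u`! <= u ^ u)%N.
Proof.
elim: u => // u IH; rewrite factS expnS leq_mul2l; apply/orP; right.
by case: u IH => // u IH; rewrite (leq_trans IH) // leq_exp2r.
Qed.

Section SparsePermutations.
Local Open Scope nat_scope.
Context {I : finType} (V : {set I}) (row : I -> nat) (M : nat).
Hypothesis row_card : forall v, v \in V -> #|[set w in V | row w == row v]%SET| = M.
Implicit Types s r : {perm I}.

Definition moved s : {set I} := [set i | s i != i]%SET.

Lemma card_moved1 : #|moved 1%g| = 0.
Proof.
apply/eqP; rewrite cards_eq0; apply/eqP/setP => i.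
by rewrite !inE perm1 eqxx.
Qed.

Definition row_perms (u : nat) : {set {perm I}} :=
  [set s : {perm I} | [&& perm_on V s, [forall i, row (s i) == row i]
    & #|moved s| == u.*2]]%SET.

(** The ordered transpositions by which [s] can be extended so as to move two further points. *)
Definition free_pairs s : {set I * I} :=
  [set x : I * I | [&& x.1 \in V :\: moved s, x.2 \in V :\: moved s,
     row x.2 == row x.1 & x.2 != x.1]]%SET.

Lemma row_perms0 : 0 < #|row_perms 0|.
Proof.
apply/card_gt0P; exists 1%g; rewrite inE perm_on1 /=; apply/andP; split.
  by apply/forallP => i; rewrite perm1.
by rewrite card_moved1.
Qed.

Lemma row_card_other v : v \in V ->
  #|[set w in V | (row w == row v) && (w != v)]%SET| = M.-1.
Proof.
move=> Vv; have := cardsD1 v [set w in V | row w == row v]%SET.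
rewrite (row_card Vv) inE Vv eqxx add1n => -> /=.
by apply: eq_card => w; rewrite !inE andbA andbC.
Qed.

(** At least |V| - 2u points of [V] are unmoved, each with M - 1 partners in its row; at most 2u (M
    - 1) of these pairs have a moved partner. *)
Lemma card_free_pairs s u : #|moved s| = u.*2 ->
  M.-1 * (#|V| - 4 * u) <= #|free_pairs s|.
Proof.
move=> mov; set F := V :\: moved s.
pose free v w := [&& w \in F, row w == row v & w != v].
have -> : #|free_pairs s| = \sum_(v in F) \sum_(w | free v w) 1.
  rewrite -sum1_card pair_big_dep /=; apply: eq_bigl => -[v w].
  by rewrite inE.
have bad_le : \sum_(v in F) \sum_(w in moved s | (w \in V) && (row w == row v) && (w != v)) 1
    <= u.*2 * M.-1.
  rewrite (exchange_big_dep (fun w => (w \in moved s) && (w \in V))) /=; last first.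
    by move=> v w _ /andP[->] /andP[/andP[->]].
  apply: (@leq_trans (\sum_(w | (w \in moved s) && (w \in V)) M.-1)).
    apply: leq_sum => w /andP[mw Vw]; rewrite -(row_card_other Vw) sum1dep_card.
    apply: subset_leq_card; apply/fintype.subsetP => v; rewrite !inE.
    by move=> /andP[/andP[_ ->]] /andP[_ /andP[/andP[_ /eqP ->]]]; rewrite eqxx eq_sym.
  rewrite sum_nat_const leq_mul2r -mov; apply/orP; right.
  by apply: subset_leq_card; apply/fintype.subsetP => w /andP[].
have split_row : \sum_(v in F) M.-1 =
    \sum_(v in F) \sum_(w | free v w) 1 +
    \sum_(v in F) \sum_(w in moved s | (w \in V) && (row w == row v) && (w != v)) 1.
  rewrite -big_split /=; apply: eq_bigr => v; rewrite inE => /andP[_ Vv].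
  rewrite -(row_card_other Vv) -sum1_card (bigID (mem (moved s))) /= addnC.
  by congr addn; apply: eq_bigl => w; rewrite /free !inE;
    case: (w \in V); case: (s w =P w); case: (row w == row v); case: (w == v).
have cF : #|V| - u.*2 <= #|F|.
  by rewrite -mov leq_subLR -(cardsID (moved s) V) leq_add2r subset_leq_card // subsetIr.
move: split_row; rewrite sum_nat_const => split_row.
have : M.-1 * (#|V| - u.*2) <= #|F| * M.-1 by rewrite mulnC leq_mul2r cF orbT.
rewrite split_row => le1.
have : M.-1 * (#|V| - u.*2) <= \sum_(v in F) \sum_(w | free v w) 1 + u.*2 * M.-1.
  by apply: leq_trans le1 _; rewrite leq_add2l.
set S := \sum_(v in F) _; rewrite !mulnBr; lia.
Qed.

Lemma extend_row_perm s u v w : s \in row_perms u -> (v, w) \in free_pairs s ->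
  [/\ (tperm v w * s)%g \in row_perms u.+1, (tperm v w * s)%g v = w
    & v \in moved (tperm v w * s)%g].
Proof.
rewrite !inE /= => /and3P[onV /forallP rows /eqP mov].
move=> /and4P[/andP[]]; rewrite !negbK => /eqP sv Vv /andP[/eqP sw Vw] /eqP rvw wv.
have tv : (tperm v w * s)%g v = w by rewrite permM tpermL.
split=> //; last by rewrite tv.
apply/and3P; split.
- apply: perm_onM => //; apply: fintype.subset_trans (tperm_on v w) _.
  by apply/fintype.subsetP => i; rewrite !inE => /orP[] /eqP ->.
- apply/forallP => i; rewrite permM (eqP (rows _)).
  by case: tpermP => [->|->|//]; rewrite rvw.
- rewrite (_ : moved _ = v |: (w |: moved s))%SET.
    by rewrite !cardsU1 !inE sv sw !eqxx !orbF (eq_sym v w) (negbTE wv) mov doubleS.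
  apply/setP => i; rewrite !inE permM.
  case: tpermP => [->|->|/eqP iv /eqP iw].
  + by rewrite sw wv eqxx.
  + by rewrite sv (eq_sym v w) wv eqxx orbT.
  + by rewrite (negbTE iv) (negbTE iw).
Qed.

(* Double counting of the maps s |-> tperm v w * s over the free pairs (v, w) of
   s: the image together with v determines s and w. *)
Lemma card_row_perms_step u :
  #|row_perms u| * (M.-1 * (#|V| - 4 * u)) <= #|row_perms u.+1| * u.+1.*2.
Proof.
pose X := [set x : {perm I} * (I * I) | (x.1 \in row_perms u) && (x.2 \in free_pairs x.1)]%SET.
pose Y := [set y : {perm I} * I | (y.1 \in row_perms u.+1) && (y.2 \in moved y.1)]%SET.
have leX : #|row_perms u| * (M.-1 * (#|V| - 4 * u)) <= #|X|.
  rewrite -sum_nat_const -[leqRHS]sum1_card.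
  rewrite (eq_bigl (fun x => (x.1 \in row_perms u) && (x.2 \in free_pairs x.1))); last first.
    by move=> x; rewrite inE.
  rewrite -(pair_big_dep (fun s => s \in row_perms u)
    (fun s x => x \in free_pairs s) (fun _ _ => 1)).
  apply: leq_sum => s; rewrite sum1_card => sT; apply: card_free_pairs.
  by move: sT; rewrite inE => /and3P[_ _ /eqP].
have leY : #|Y| <= #|row_perms u.+1| * u.+1.*2.
  rewrite -sum_nat_const -[leqLHS]sum1_card.
  rewrite (eq_bigl (fun x => (x.1 \in row_perms u.+1) && (x.2 \in moved x.1))); last first.
    by move=> x; rewrite inE.
  rewrite -(pair_big_dep (fun s => s \in row_perms u.+1)
    (fun s i => i \in moved s) (fun _ _ => 1)).
  apply: leq_sum => s; rewrite sum1_card => sT.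
  by move: sT; rewrite inE => /and3P[_ _ /eqP ->].
apply: leq_trans leX (leq_trans _ leY).
pose phi (x : {perm I} * (I * I)) := ((tperm x.2.1 x.2.2 * x.1)%g, x.2.1).
rewrite -(card_in_imset (f := phi)); last first.
  move=> [s [v w]] [s' [v' w']]; rewrite ![_ \in X]inE /= => /andP[sT vw] /andP[sT' vw'] [e ev].
  subst v'.
  have [_ tv _] := extend_row_perm sT vw; have [_ tv' _] := extend_row_perm sT' vw'.
  have ew : w = w' by rewrite -tv -tv' e.
  by subst w'; move/mulgI: e => ->.
apply: subset_leq_card; apply/fintype.subsetP => _ /imsetP[[s [v w]] + ->].
rewrite [_ \in X]inE /= => /andP[sT vw].
by have [r1 _ r2] := extend_row_perm sT vw; rewrite [_ \in Y]inE /= r1 r2.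
Qed.

(** While 8 k <= |V|, passing from k to k + 1 multiplies the count by at least (M - 1) |V| / (4 (k +
    1)); the denominators collect to 4^u u!. *)
Lemma card_row_perms u : 8 * u.-1 <= #|V| ->
  (M.-1 * #|V|) ^ u <= #|row_perms u| * (4 * u) ^ u.
Proof.
move=> u8.
suff aux k : 8 * k.-1 <= #|V| -> (M.-1 * #|V|) ^ k <= #|row_perms k| * (4 ^ k * k`!).
  apply: leq_trans (aux u u8) _; rewrite expnMn leq_mul2l leq_mul2l.
  by rewrite fact_le_exp !orbT.
elim: k => [|k IH] k8; first by rewrite expn0 fact0 !muln1 row_perms0.
have {}IH : (M.-1 * #|V|) ^ k <= #|row_perms k| * (4 ^ k * k`!) by apply: IH; lia.
have step := card_row_perms_step k.
have halfV : #|V| <= 2 * (#|V| - 4 * k) by rewrite /= in k8; lia.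
rewrite expnSr; apply: leq_trans (leq_mul IH (leqnn _)) _.
apply: (@leq_trans (2 * (#|row_perms k| * (M.-1 * (#|V| - 4 * k))) * (4 ^ k * k`!))).
  rewrite (_ : _ * _ * (_ * #|V|) = #|row_perms k| * M.-1 * (4 ^ k * k`!) * #|V|); last by lia.
  rewrite (_ : 2 * _ * _ = #|row_perms k| * M.-1 * (4 ^ k * k`!) * (2 * (#|V| - 4 * k))).
    by rewrite leq_mul2l halfV orbT.
  by lia.
rewrite (_ : #|row_perms k.+1| * _ =
    2 * (#|row_perms k.+1| * k.+1.*2) * (4 ^ k * k`!)); last by rewrite expnS factS -muln2; lia.
by rewrite leq_mul2r leq_mul2l step !orbT.
Qed.

End SparsePermutations.

(** The number of swaps, of order h but capped near v / 64. The fourth condition is the one of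
    [card_row_perms]; the last makes the base (M - 1) v / (4 u) of the resulting power at least
    8. *)
Lemma swap_count (v h : nat) : (64 <= v)%N -> (2 <= h <= 9 * v)%N ->
  exists u, [/\ (0 < u)%N, (u.*2 <= h)%N, (h <= 24 * 24 * u)%N,
    (8 * u.-1 <= v)%N & (32 * u <= v)%N].
Proof. by move=> ? ?; exists (minn (h %/ 2) (1 + v %/ 64)); split; lia. Qed.

(** * Labelings obtained from sparse permutations *)

Section PermutedLabelings.
Context {R : realType} {n m : nat}.
Context (m2 : (2 <= m)%N) (nm : (2 * m <= n)%N).

Let V : {set 'I_n} := [set i | @mobile n m i]%SET.
Let M := @code_size m.

Lemma mobile_lt (i : 'I_n) : @mobile n m i -> (i %/ m < n %/ m)%N.
Proof. by move=> /andP[ip _]; rewrite (leq_trans ip) // /mobile_rows leq_div. Qed.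

Lemma base_mobileE (i : 'I_n) : @mobile n m i -> base (ltnW m2) i = (i %% m)%N :> nat.
Proof.
move=> mob; apply: (base_row (ltnW m2) (mobile_lt mob)); last exact: divn_eq.
by rewrite ltn_mod ltnW.
Qed.

Lemma mobile_row_card (v : 'I_n) : v \in V ->
  #|[set w in V | (w %/ m == v %/ m)%N]%SET| = M.
Proof.
rewrite inE => mv; have vq := mobile_lt mv.
have node_lt (c : 'I_M) : (v %/ m * m + c < n)%N.
  have cm : (c < m)%N := leq_trans (ltn_ord c) (code_size_le m2).
  have : ((v %/ m).+1 * m <= n %/ m * m)%N by rewrite leq_mul2r vq orbT.
  by have := leq_trunc_div n m; rewrite mulSn; lia.
pose node c := Ordinal (node_lt c).
have node_inj : injective node by move=> c c' /(congr1 val) /= /addnI/val_inj.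
rewrite -[RHS](card_ord M) -(card_imset _ node_inj); apply: eq_card => w.
rewrite !inE; apply/andP/imsetP => [[mw /eqP wv]|[c _ ->]].
  have /andP[_ wM] := mw; exists (Ordinal wM) => //; apply: val_inj => /=.
  by rewrite -wv -divn_eq.
have cm : (c < m)%N := leq_trans (ltn_ord c) (code_size_le m2).
rewrite /mobile /= (divn_row (ltnW m2)) // modnMDl modn_small //.
by move: mv => /andP[-> _]; rewrite ltn_ord eqxx.
Qed.

Lemma card_mobile : (n <= 9 * #|V|)%N.
Proof.
apply: leq_trans (mobile_count m2 nm) _; rewrite leq_mul2l /=.
rewrite -(ler_nat R) -sum1_card natr_sum big_mkcond /=.
apply: (@le_trans _ _ (\sum_(r < @mobile_rows n m) \sum_(c < M) 1)); last first.
  apply: (@sum_rows_le _ _ (ltnW m2) _ 0 _ _ (fun _ _ => 1) _ _ (code_size_le m2)).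
  - by rewrite add0n /mobile_rows leq_div.
  - by move=> i; case: ifP.
  - move=> r c i e; have cm : (c < m)%N := leq_trans (ltn_ord c) (code_size_le m2).
    rewrite inE /mobile e add0n (divn_row (ltnW m2)) // modnMDl modn_small //.
    by rewrite !ltn_ord.
under eq_bigr do rewrite sumr_const card_ord.
by rewrite sumr_const card_ord -mulrnA mulnC.
Qed.

Definition sparse_perms (h : nat) : {set {perm 'I_n}} :=
  [set s : {perm 'I_n} | [&& perm_on V s, [forall i, (s i %/ m == i %/ m)%N]
    & (#|moved s| <= h)%N]]%SET.

Lemma card_sparse_perms (h u : nat) : (0 < u)%N -> (u.*2 <= h)%N ->
  (#|row_perms V (fun i : 'I_n => i %/ m)%N u| < #|sparse_perms h|)%N.
Proof.
move=> u0 uh; rewrite (cardsD1 1%g (sparse_perms h)).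
have -> : 1%g \in sparse_perms h.
  rewrite inE perm_on1 card_moved1 andbT /=.
  by apply/forallP => i; rewrite perm1.
rewrite add1n ltnS; apply: subset_leq_card; apply/fintype.subsetP => s.
rewrite !inE => /and3P[-> -> /eqP mov]; rewrite mov uh !andbT /=.
apply: contraL u0 => /eqP s1; move: mov; rewrite s1 card_moved1.
by case: u {uh}.
Qed.

Lemma sparse_perm_good (h : nat) s : s \in sparse_perms h ->
  code_labeling m2 (fun i => base (ltnW m2) (s i)).
Proof.
rewrite inE => /and3P[onV _ _]; split=> i mi; first by rewrite (out_perm onV) ?inE.
have := perm_closed i onV; rewrite !inE mi => ms; exact: (base_mobile m2 ms).
Qed.

(** The label of a mobile node is its column, and the permutation preserves rows, so the labels
    determine the image of every mobile node. *)
Lemma sparse_perm_inj (h : nat) s s' : s \in sparse_perms h -> s' \in sparse_perms h ->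
  (fun i => base (ltnW m2) (s i)) =1 (fun i => base (ltnW m2) (s' i)) -> s = s'.
Proof.
rewrite !inE => /and3P[onV /forallP rows _] /and3P[onV' /forallP rows' _] e.
apply/permP => i; have [mi|nmi] := boolP (i \in V); last by rewrite !(out_perm _ nmi).
have ms : @mobile n m (s i) by move: mi; rewrite -(perm_closed i onV) inE.
have ms' : @mobile n m (s' i) by move: mi; rewrite -(perm_closed i onV') inE.
have /= ei := e i; have := congr1 (@nat_of_ord m) ei.
rewrite (base_mobileE ms) (base_mobileE ms') => emod.
by apply: val_inj; rewrite /= (divn_eq (s i) m) (divn_eq (s' i) m) (eqP (rows i))
  (eqP (rows' i)) emod.
Qed.

Lemma sparse_perm_dist (h : nat) s : s \in sparse_perms h ->
  (hdist (fun i => base (ltnW m2) (s i)) (base (ltnW m2)) <= h)%N.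
Proof.
rewrite inE => /and3P[_ _]; apply: leq_trans; apply: subset_leq_card.
by apply/fintype.subsetP => i; rewrite !inE; apply: contra => /eqP ->.
Qed.

Lemma perm_class_size (s : {perm 'I_n}) k :
  #|[pred i : 'I_n | base (ltnW m2) (s i) == k]| =
  #|[pred i : 'I_n | base (ltnW m2) i == k]|.
Proof. by rewrite -!sum1_card [RHS](reindex_inj (@perm_inj _ s)). Qed.

(** From exp (-1/2) >= 1 - 1/2, hence exp (1/2) <= 2; [ln2_ge] rests on the same bound. *)
Lemma expR1_le4 : expR 1 <= 4 :> R.
Proof.
have e0 : 0 < expR 2^-1 :> R := expR_gt0 _.
have -> : expR 1 = (expR 2^-1) ^+ 2 :> R by rewrite -expRM_natl divff // pnatr_eq0.
have : expR 2^-1 * expR (- 2^-1) = 1 :> R by rewrite expRxMexpNx_1.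
have := expR_ge1Dx (- 2^-1 : R); nra.
Qed.

Lemma ln2_ge : 2^-1 <= ln 2 :> R.
Proof.
rewrite -[leLHS]expRK ler_ln ?posrE ?expR_gt0 //.
have e0 : 0 < expR 2^-1 :> R := expR_gt0 _.
have : expR 2^-1 * expR (- 2^-1) = 1 :> R by rewrite expRxMexpNx_1.
have := expR_ge1Dx (- 2^-1 : R); nra.
Qed.

(** With few mobile nodes all quantities are bounded and two permutations suffice. Otherwise the
    count is at least B^u with u of order h and [log_moves h] at most 4 ln B. *)
Lemma ln_card_sparse_perms (h : nat) : (2 <= h <= n)%N ->
  (1 < #|sparse_perms h|)%N /\
  24^-1 ^+ 6 * (h%:R * log_moves (n := n) (m := m) h) <= ln #|sparse_perms h|%:R :> R.
Proof.
move=> /andP[h2 hn]; have V9 := card_mobile.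
have M2 : (2 <= M)%N := code_size_ge2 m2.
have M4 : (m <= 4 * M.-1)%N by have := @lt_code_size m; rewrite -/M; lia.
have V0 : (0 < #|V|)%N by lia.
have n0 : (0 < n)%N by lia.
have m0 : (0 < m)%N by lia.
have card2 : (1 < #|sparse_perms h|)%N.
  apply: leq_ltn_trans (@card_sparse_perms h 1 _ _) => //.
  rewrite lt0n; apply/negP => /eqP T0.
  have := @card_row_perms _ V (fun i : 'I_n => i %/ m)%N M mobile_row_card 1.
  by rewrite T0 !expn1 => /(_ isT); nia.
split=> //; set F := #|sparse_perms h| in card2 *.
have F2 : ln 2 <= ln F%:R :> R.
  by rewrite ler_ln ?posrE ?ltr0n ?(ltn_trans _ card2) // ler_nat.
have h01 : (0 < h <= n)%N by rewrite hn (ltn_trans _ h2).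
have l1 := @log_moves_ge1 R n m m2 h h01.
have l2n := @log_moves_le R n m m2 nm h h01.
set l := log_moves h in l1 l2n *.
have hnR : h%:R <= n%:R :> R by rewrite ler_nat.
have h2R : 2 <= h%:R :> R by rewrite ler_nat.
(* [y] is made opaque below, and powers of 24 are cancelled through [yX] instead of being
   computed. *)
pose y : R := 24^-1; have y24 : y * 24 = 1 by rewrite mulVf ?pnatr_eq0.
have y0 : 0 < y by rewrite invr_gt0 ltr0n.
have c0 : 0 < y ^+ 6 by rewrite exprn_gt0.
have yX j x : y ^+ j.+2 * (24 * 24 * x) = y ^+ j * x.
  rewrite (_ : _ * _ = y ^+ j * (y * 24) ^+ 2 * x); last by rewrite !exprS; ring.
  by rewrite y24 expr1n mulr1.
have y2 : y ^+ 2 <= 4^-1.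
  have : y <= 2^-1 by lra.
  by rewrite expr2; nra.
have y4 : y ^+ 4 <= 4^-1.
  by rewrite (exprD y 2 2); have := sqr_ge0 y; nra.
rewrite -/y; clearbody y.
have ln2 := ln2_ge.
(* Here n <= 9 * 64 = 24^2, so h l <= 2 n^2 is at most 2 * 24^4, and y^6 brings it below 1/2 <= ln
   2. *)
have [V64|V64] := ltnP #|V| 64.
  have n576 : n%:R <= 24 * 24 :> R
    by rewrite -natrM ler_nat (leq_trans V9) // (leq_mul (leqnn 9) (ltnW V64)).
  apply: (@le_trans _ _ (y ^+ 6 * (24 * 24 * (24 * 24 * 2)))).
    by rewrite ler_pM2l // ler_pM //; lra.
  by rewrite !yX; apply: le_trans F2; lra.
have [|u [u0 uh hu u8 u32]] := @swap_count #|V| h V64.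
  by rewrite h2 (leq_trans hn).
have := leq_trans (card_row_perms mobile_row_card u8)
  (leq_mul (ltnW (card_sparse_perms u0 uh)) (leqnn _)).
rewrite -/F -(ler_nat R) natrM !natrX => cardF.
have u0R : 0 < u%:R :> R by rewrite ltr0n.
have u40 : 0 < (4 * u)%:R :> R by rewrite ltr0n muln_gt0.
pose B : R := (M.-1 * #|V|)%:R / (4 * u)%:R.
have BuF : B ^+ u <= F%:R by rewrite expr_div_n ler_pdivrMr // exprn_gt0.
have M1 : (0 < M.-1)%N by rewrite -subn1 subn_gt0.
have B8 : 8 <= B.
  by rewrite ler_pdivlMr // -natrM ler_nat mulnA (leq_trans u32) // leq_pmull.
(* The chain is m n e <= 144 u B * 4 <= 8^3 B (2 u) <= B^4 h. *)
have lB : l <= 4 * ln B.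
  have BE : ln (B ^+ 4) = 4 * ln B by rewrite lnXn ?mulr_natl //; lra.
  have hR : 0 < h%:R :> R by lra.
  have mn0 : 0 < m%:R * n%:R * expR 1 :> R.
    by rewrite !mulr_gt0 ?expR_gt0 // ltr0n.
  rewrite -BE ler_ln ?posrE ?divr_gt0 ?exprn_gt0 //; last by lra.
  have e4 := expR1_le4.
  have mnB : m%:R * n%:R <= 144 * u%:R * B.
    rewrite (_ : 144 * u%:R * B = 36 * (M.-1 * #|V|)%:R); last first.
      by rewrite /B natrM; field; rewrite gt_eqF.
    by rewrite -!natrM ler_nat (leq_trans (leq_mul M4 V9)) // mulnACA.
  have uhR : 2 * u%:R <= h%:R :> R by rewrite -natrM ler_nat mul2n.
  rewrite ler_pdivrMr //.
  apply: (@le_trans _ _ (144 * u%:R * B * 4)).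
    by rewrite ler_pM ?expR_ge0 // mulr_ge0.
  have B0 : 0 <= B by lra.
  have B3 : 8 ^+ 3 <= B ^+ 3 by rewrite lerXn2r ?nnegrE //; lra.
  apply: (@le_trans _ _ (8 ^+ 3 * B * (2 * u%:R))).
    by have := mulr_ge0 (ltW u0R) B0; lra.
  rewrite (exprSr B) ler_pM ?mulr_ge0 ?exprn_ge0 //.
  by rewrite ler_wpM2r.
have lF : u%:R * ln B <= ln F%:R.
  rewrite mulr_natl -lnXn; last by lra.
  rewrite ler_ln ?posrE ?exprn_gt0 //; first by lra.
  by rewrite ltr0n (ltn_trans _ card2).
apply: le_trans lF.
have huR : h%:R <= 24 * 24 * u%:R :> R by rewrite -!natrM ler_nat.
have B0 : 0 <= ln B by rewrite ln_ge0 //; lra.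
apply: (@le_trans _ _ (y ^+ 6 * (24 * 24 * (u%:R * (4 * ln B))))).
  by rewrite ler_pM2l // mulrA ler_pM //; lra.
rewrite yX; have uB := mulr_ge0 (ltW u0R) B0.
by have := ler_wpM2r (mulr_ge0 (ltW u0R) B0) y4; lra.
Qed.

End PermutedLabelings.

(** * Single moves *)

Section SingleMoves.
Context {R : realType} {n m : nat}.
Context (m2 : (2 <= m)%N) (nm : (2 * m <= n)%N).
Let zbase := @base n m (ltnW m2).

Definition relabel (i0 : 'I_n) (k : 'I_m) (i : 'I_n) : 'I_m :=
  if i == i0 then k else zbase i.

Lemma relabel_inj i0 i1 k0 k1 : zbase i0 != k0 -> zbase i1 != k1 ->
  relabel i0 k0 =1 relabel i1 k1 -> i0 = i1 /\ k0 = k1.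
Proof.
move=> b0 b1 e; have := e i0; rewrite /relabel eqxx.
case: eqP => [-> //|_ e0]; by move: b0; rewrite e0 eqxx.
Qed.

Lemma hdist_relabel i0 k : (hdist (relabel i0 k) zbase <= 1)%N.
Proof.
rewrite -(card1 i0); apply: subset_leq_card; apply/fintype.subsetP => i.
by rewrite !inE /relabel; case: (eqVneq i i0) => // _; rewrite eqxx.
Qed.

Lemma class_size_relabel i0 k k' :
  (#|[pred i | relabel i0 k i == k']| + (zbase i0 == k') =
   #|[pred i | zbase i == k']| + (k == k'))%N.
Proof.
have cardE (z : 'I_n -> 'I_m) :
    (#|[pred i | z i == k']| = \sum_(i < n) (z i == k'))%N.
  by rewrite -sum1_card big_mkcond.
rewrite !cardE (bigD1 i0) //= [in RHS](bigD1 i0) //=.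
rewrite (eq_bigr (fun i => nat_of_bool (zbase i == k'))) => [|i /negbTE ne].
  by rewrite /relabel eqxx; lia.
by rewrite /relabel ne.
Qed.

Let p := @mobile_rows n m.
Let M := @code_size m.

Lemma mobile_node_lt (r : 'I_p) (c : nat) : (c < m)%N -> (r * m + c < n)%N.
Proof.
clear nm => cm; have rq : (r < n %/ m)%N by rewrite (leq_trans (ltn_ord r)) // leq_div.
have : (r.+1 * m <= n %/ m * m)%N by rewrite leq_mul2r rq orbT.
by have := leq_trunc_div n m; rewrite mulSn; lia.
Qed.

Lemma code_label_lt (c : 'I_M.-1) : (c.+1 < m)%N.
Proof.
by clear nm; have := ltn_ord c; have := code_size_le m2; have := code_size_ge2 m2; rewrite -/M; lia.
Qed.

Definition class0 : 'I_m := Ordinal (ltnW m2).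
Definition class1 : 'I_m := Ordinal m2.
Definition code_label (c : 'I_M.-1) : 'I_m := Ordinal (code_label_lt c).
Definition mobile_node (r : 'I_p) (k : 'I_m) : 'I_n :=
  Ordinal (mobile_node_lt r (ltn_ord k)).

(* Classes that can give up a node, class 0 being always able to receive one;
   the other classes can receive one from class 1. *)
Definition donor (k : nat) : bool := (n %% m == 0)%N || (k <= n %% m)%N.

(** [None] adds the unmoved labeling, without which the family could have a single member. *)
Definition single_move (x : option ('I_p * 'I_M.-1)) : 'I_n -> 'I_m :=
  if x is Some (r, c) then
    if donor c.+1 then relabel (mobile_node r (code_label c)) class0
    else relabel (mobile_node r class1) (code_label c)
  else zbase.

Lemma base_mobile_node r k : zbase (mobile_node r k) = k.
Proof.
apply: val_inj; apply: (base_row (ltnW m2) (r := r) (c := k)) => //.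
by rewrite (leq_trans (ltn_ord r)) // leq_div.
Qed.

Lemma mobile_node_inj r r' k k' : mobile_node r k = mobile_node r' k' -> r = r' /\ k = k'.
Proof.
move=> e; have := congr1 (fun i : 'I_n => i %/ m)%N e.
rewrite /= !(divn_row (ltnW m2)) // => /val_inj ->; split=> //.
by rewrite -(base_mobile_node r k) e base_mobile_node.
Qed.

Lemma donor1 : donor 1.
Proof. by rewrite /donor; case: (n %% m)%N. Qed.

Lemma not_donor_neq1 (c : 'I_M.-1) : ~~ donor c.+1 -> class1 != code_label c.
Proof. by apply: contra => /eqP/(congr1 val) /= <-; exact: donor1. Qed.

Lemma single_move_good x : code_labeling m2 (single_move x).
Proof.
have M2 : (1 < M)%N := code_size_ge2 m2.
suff good_relabel r (k k' : 'I_m) : (k < M)%N -> (k' < M)%N ->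
    code_labeling m2 (relabel (mobile_node r k) k').
  case: x => [[r c]|] /=; last by split=> // i; exact: base_mobile.
  have cM : (code_label c < M)%N by rewrite /= -ltn_predRL.
  by case: ifP => _; apply: good_relabel => //; rewrite /= ltnW.
move=> kM k'M; split=> i mi; rewrite /relabel; case: eqP => // e.
  move: mi; rewrite e /mobile /= (divn_row (ltnW m2)) // modnMDl modn_small //.
  by rewrite kM ltn_ord.
exact: base_mobile.
Qed.

Lemma single_move_inj x y : single_move x =1 single_move y -> x = y.
Proof.
have neq0 r c : zbase (mobile_node r (code_label c)) != class0.
  by rewrite base_mobile_node.
have neq1 r (c : 'I_M.-1) : ~~ donor c.+1 -> zbase (mobile_node r class1) != code_label c.
  by move=> nd; rewrite base_mobile_node not_donor_neq1.
have moved i0 k : zbase i0 != k -> ~ relabel i0 k =1 zbase.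
  by move=> b /(_ i0); rewrite /relabel eqxx => e; rewrite e eqxx in b.
case: x => [[r c]|]; case: y => [[r' c']|] //=.
- case: ifPn => d; case: ifPn => d' e.
  + have [/mobile_node_inj[-> /(congr1 val) /= [/val_inj ->]] //] :=
      relabel_inj (neq0 r c) (neq0 r' c') e.
  + by have [_ /(congr1 val)] := relabel_inj (neq0 r c) (neq1 r' c' d') e.
  + by have [_ /(congr1 val)] := relabel_inj (neq1 r c d) (neq0 r' c') e.
  + have [/mobile_node_inj[-> _] /(congr1 val) /= [/val_inj ->] //] :=
      relabel_inj (neq1 r c d) (neq1 r' c' d') e.
- by case: ifPn => d /moved []; [exact: neq0|exact: neq1].
- by case: ifPn => d /fsym/moved []; [exact: neq0|exact: neq1].
Qed.

Lemma single_move_dist x : (hdist (single_move x) zbase <= 1)%N.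
Proof.
case: x => [[r c]|] /=; first by case: ifP => _; exact: hdist_relabel.
by rewrite /hdist eq_card0 // => i; rewrite inE eqxx.
Qed.

(** If m does not divide n, the class that gives a node up has size n / m + 1 and the receiving one
    n / m, so the two sizes are merely exchanged. If m divides n, all sizes are n / m and the move
    creates n / m - 1 and n / m + 1. *)
Lemma single_move_sizes (bal : pred nat) :
  bal (n %/ m)%N -> ((0 < n %% m)%N -> bal (n %/ m).+1) ->
  ((m %| n)%N -> bal (n %/ m).-1 /\ bal (n %/ m).+1) ->
  forall x k, bal #|[pred i | single_move x i == k]|.
Proof.
move=> balq balr baldvd x k.
have basek : #|[pred i | zbase i == k]| = (n %/ m + (0 < k <= n %% m))%N by exact: card_base.
have q2 := quotient_ge2 m2 nm.
have bals s : (s = n %/ m \/ (s = (n %/ m).+1 \/ s = (n %/ m).-1 /\ (m %| n)%N))%N -> bal s.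
  case=> [->//|[->|[-> /baldvd[] //]]].
  by case: (posnP (n %% m)) => [/eqP/baldvd[]//|/balr].
case: x => [[r c]|] /=; last first.
  by apply: bals; rewrite basek; case: (_ && _) => /=; lia.
have ck : (code_label c == k) = (c.+1 == k :> nat) by [].
case: ifPn => d; apply: bals.
  have := class_size_relabel (mobile_node r (code_label c)) class0 k.
  rewrite base_mobile_node basek ck -(inj_eq val_inj) /=.
  move: d; rewrite /donor /dvdn; move: #|_| (n %/ m)%N (n %% m)%N q2 => s q r' q2.
  by lia.
have := class_size_relabel (mobile_node r class1) (code_label c) k.
rewrite base_mobile_node basek ck -(inj_eq val_inj) /=.
move: d; rewrite /donor /dvdn; move: #|_| (n %/ m)%N (n %% m)%N q2 => s q r' q2.
by lia.
Qed.

(** With x the size of the family, n <= 18 x <= x^6 and e <= 4 <= x^2 since x >= 2, so m n e <=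
    x^14. *)
Lemma ln_card_single_moves :
  (1 < #|{: option ('I_p * 'I_M.-1)}|)%N /\
  24^-1 ^+ 6 * (1%:R * log_moves (n := n) (m := m) 1) <=
    ln #|{: option ('I_p * 'I_M.-1)}|%:R :> R.
Proof.
have cardA : #|{: option ('I_p * 'I_M.-1)}| = (p * M.-1).+1.
  by rewrite card_option card_prod !card_ord.
have M1 : (0 < M.-1)%N by have := code_size_ge2 m2; rewrite -/M; lia.
have p0 : (0 < p)%N by have := quotient_ge2 m2 nm; rewrite /p /mobile_rows; lia.
have n18 : (n <= 18 * (p * M.-1).+1)%N.
  have := mobile_count m2 nm; rewrite -/p -/M.
  have : (p * M <= p * M.-1 * 2)%N by rewrite -mulnA leq_mul2l; lia.
  by lia.
rewrite cardA; split; first by rewrite ltnS muln_gt0 p0.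
have x2 : 2 <= (p * M.-1).+1%:R :> R by rewrite ler_nat ltnS muln_gt0 p0.
have n18R : n%:R <= 18 * (p * M.-1).+1%:R :> R by rewrite -natrM ler_nat.
move: ((p * M.-1).+1%:R) x2 n18R => x x2 n18R.
have mR : m%:R <= n%:R :> R by rewrite ler_nat; lia.
have m1 : 1 <= m%:R :> R by rewrite ler1n ltnW.
have x0 : 0 < x by lra.
have nx : n%:R <= x ^+ 6.
  apply: le_trans n18R _; rewrite exprSr ler_pM2r //.
  have : 2 ^+ 5 <= x ^+ 5 by rewrite lerXn2r ?nnegrE //; lra.
  by lra.
have ex : expR 1 <= x ^+ 2.
  have : 2 ^+ 2 <= x ^+ 2 by rewrite lerXn2r ?nnegrE //; lra.
  by have := @expR1_le4 R; lra.
have lx : @log_moves R n m 1 <= 14 * ln x.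
  have -> : 14 * ln x = ln (x ^+ 14) by rewrite lnXn // mulr_natl.
  have mne0 : 0 < m%:R * n%:R * expR 1 :> R by rewrite !mulr_gt0 ?expR_gt0 //; lra.
  rewrite /log_moves divr1 ler_ln ?posrE ?exprn_gt0 //.
  rewrite (_ : x ^+ 14 = x ^+ 6 * x ^+ 6 * x ^+ 2); last by rewrite -!exprD.
  by rewrite !ler_pM ?mulr_ge0 ?expR_ge0 //; lra.
have lnx : 0 <= ln x by rewrite ln_ge0 //; lra.
have y24 : (24^-1 : R) ^+ 6 <= 24^-1.
  by apply: ler_iXnr => //; lra.
have y0 : 0 <= (24^-1 : R) ^+ 6 by rewrite exprn_ge0 // invr_ge0.
rewrite mul1r; apply: le_trans (ler_wpM2l y0 lx) _.
by have := ler_wpM2r lnx y24; lra.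
Qed.

End SingleMoves.

(** * Clustering terms *)

Section ClusteringTerms.
Context {R : realType} {n m L n0 : nat} {al1 al2 nu0 K0 : R} {H : 'M[R]_L}.
Context (m2 : (2 <= m)%N) (nm : (2 * m <= n)%N) (L2 : (2 <= L)%N).
Context (nu00 : 0 < nu0) (K00 : 0 <= K0).
Hypothesis Hones : maps_ones_to_e1 H.

Let c0 : R := 24^-1 ^+ 6.

Definition clustering_const : R := c0 ^+ 2 / (16 * 216 * 72 * (1 + ln (18 / c0))).

Lemma c0_bounds : 0 < c0 <= 1.
Proof.
have y0 : 0 <= (24^-1 : R) by rewrite invr_ge0.
rewrite exprn_gt0 ?invr_gt0 ?ltr0n //=.
by apply: exprn_ile1 => //; lra.
Qed.

Lemma clustering_const_gt0 : 0 < clustering_const.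
Proof.
have /andP[c00 c01] := c0_bounds.
rewrite divr_gt0 ?exprn_gt0 // mulr_gt0 ?mulr_gt0 ?ltr0n //.
have : 0 <= ln (18 / c0) by rewrite ln_ge0 // ler_pdivlMr //; lra.
by lra.
Qed.

Let bal := @balanced R m n al1 al2.
Let zbase := @base n m (ltnW m2).

Lemma hdistC (z z' : 'I_n -> 'I_m) : hdist z z' = hdist z' z.
Proof. by apply: eq_card => i; rewrite !inE eq_sym. Qed.

Lemma hdistxx (z : 'I_n -> 'I_m) : hdist z z = 0%N.
Proof. by apply: eq_card0 => i; rewrite inE eqxx. Qed.

Lemma label_mx_Zbal (Z : 'I_L -> 'I_n -> 'I_m) :
  (forall l l' : 'I_L, l' = l.+1 :> nat -> (hdist (Z l) (Z l') <= n0)%N) ->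
  (forall l k, bal #|[pred i | Z l i == k]|) ->
  Zbal m n L n0 al1 al2 (fun l => label_mx (Z l)).
Proof.
move=> mov sizes; split=> [l|l l' ll'|l k]; first exact: label_mx_clustering.
  by rewrite movers_label_mx; exact: mov.
by rewrite class_size_label_mx; exact: sizes.
Qed.

(** With [base] at the even times, consecutive labelings differ by the moves of one hypothesis only,
    at most [n0], although the hypotheses at different odd times are chosen independently. *)
Let odd_layer (l : 'I_L) : option 'I_(L./2) := if odd l then insub l./2 else None.

Lemma odd_layer_card s : #|[pred l | odd_layer l == Some s]| = 1%N.
Proof.
have lt : (s.*2.+1 < L)%N by have := ltn_ord s; lia.
rewrite -(card1 (Ordinal lt)); apply: eq_card => l; rewrite !inE /odd_layer.
apply/eqP/eqP => [|->] /=.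
  case: (boolP (odd l)) => // ol; case: insubP => // t _ el [ts].
  by apply: val_inj; move: el; rewrite ts /=; lia.
rewrite odd_double /= uphalf_double; case: insubP => [t _ et|].
  by congr Some; apply: val_inj.
by rewrite ltn_ord.
Qed.

Lemma dynamic_testing (A : finType) (zz : A -> 'I_n -> 'I_m)
    (hatLam : tensor bool n L -> tensor R n L) :
  (0 < n0 <= n)%N ->
  (forall a, code_labeling m2 (zz a)) -> (forall a b, zz a =1 zz b -> a = b) ->
  (forall a, hdist (zz a) zbase <= n0)%N ->
  (forall a k, bal #|[pred i | zz a i == k]|) ->
  (forall k, bal #|[pred i | zbase i == k]|) ->
  (1 < #|A|)%N -> c0 * (n0%:R * @log_moves R n m n0) <= ln #|A|%:R ->
  exists2 Lam, dsbm_class (smooth_class (m := m) H nu0 K0) (Zbal m n L n0 al1 al2) Lam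
    & 4^-1 <= Pr Lam (fun B => clustering_const *
        ((L./2)%:R * (n0%:R * @log_moves R n m n0)) <= sqnorm (hatLam B - Lam)).
Proof.
move=> hn0 goodz zz_inj dist balz balb A1 lnA.
have := clustering_testing nm odd_layer_card hatLam isT _ hn0 c0_bounds goodz
  zz_inj dist A1 lnA.
rewrite card_ord; apply=> [|f|del]; first by lia.
  apply: label_mx_Zbal => [l l' ll'|l k].
    rewrite /layers /odd_layer ll' /=; case: (boolP (odd l)) => ol /=.
      by case: insubP => [s _ _|_]; rewrite ?hdistxx.
    case: insubP => [s _ _|_]; last by rewrite hdistxx.
    by rewrite hdistC.
  by rewrite /layers; case: (odd_layer l) => [s|]; [exact: balz|exact: balb].
exact: pattern_conn_smooth.
Qed.

Section Balanced.
Context (balq : bal (n %/ m)) (balr : (0 < n %% m)%N -> bal (n %/ m).+1).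

Lemma base_bal k : bal #|[pred i | zbase i == k]|.
Proof. exact: (base_balanced (ltnW m2)). Qed.

Let sparse_type h := {s : {perm 'I_n} | s \in @sparse_perms n m h}.
Let sparse_label h (a : sparse_type h) (i : 'I_n) : 'I_m := zbase (val a i).

Lemma card_sparse_type h : #|{: sparse_type h}| = #|@sparse_perms n m h|.
Proof. by rewrite card_sig; apply: eq_card => s; rewrite inE. Qed.

Lemma sparse_label_inj h (a b : sparse_type h) :
  sparse_label a =1 sparse_label b -> a = b.
Proof.
by move=> e; apply: val_inj; apply: (sparse_perm_inj (valP a) (valP b) e).
Qed.

(** A single layer lasts for all times, so no node ever changes class; for h = n the logarithm is ln
    (m e). *)
Lemma static_lower_bound (hatLam : tensor bool n L -> tensor R n L) :
  exists2 Lam, dsbm_class (smooth_class (m := m) H nu0 K0) (Zbal m n L n0 al1 al2) Lam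
    & 4^-1 <= Pr Lam (fun B => clustering_const *
        (n%:R * @log_moves R n m n) <= sqnorm (hatLam B - Lam)).
Proof.
have n2 : (2 <= n <= n)%N by rewrite leqnn andbT; lia.
have [card1 lnA] := @ln_card_sparse_perms R n m m2 nm n n2.
rewrite -card_sparse_type in card1 lnA.
have tauW (s : unit) : #|[pred l : 'I_L | Some tt == Some s]| = L.
  by rewrite -[RHS]card_ord; apply: eq_card => l; rewrite !inE; case: s.
have := @clustering_testing R n m L m2 nm unit (fun=> Some tt) L tauW (sparse_type n)
  (@sparse_label n) n c0 _ _ hatLam _ _ _ c0_bounds _ (@sparse_label_inj n) _ card1 lnA.
rewrite card_unit mul1r; apply=> //.
- exact: ltnW.
- by rewrite leqnn andbT; lia.
- by move=> a; exact: sparse_perm_good (valP a).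
- by move=> a; exact: sparse_perm_dist (valP a).
- move=> f; apply: label_mx_Zbal => [l l' _|l k]; first by rewrite hdistxx.
  by rewrite perm_class_size; exact: base_bal.
- by move=> del; exact: pattern_conn_smooth.
Qed.

Lemma dynamic_lower_bound (hatLam : tensor bool n L -> tensor R n L) :
  (0 < n0 <= n)%N ->
  (n0 = 1%N -> (m %| n)%N -> bal (n %/ m).-1 /\ bal (n %/ m).+1) ->
  exists2 Lam, dsbm_class (smooth_class (m := m) H nu0 K0) (Zbal m n L n0 al1 al2) Lam
    & 4^-1 <= Pr Lam (fun B => clustering_const *
        ((L./2)%:R * (n0%:R * @log_moves R n m n0)) <= sqnorm (hatLam B - Lam)).
Proof.
move=> hn0 bal1; case: (ltnP 1 n0) => [n02|n01].
  have n02n : (2 <= n0 <= n)%N by rewrite n02; case/andP: hn0.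
  have [card1 lnA] := @ln_card_sparse_perms R n m m2 nm n0 n02n.
  rewrite -card_sparse_type in card1 lnA.
  apply: (@dynamic_testing _ (@sparse_label n0)) => //.
  - by move=> a; exact: sparse_perm_good (valP a).
  - exact: sparse_label_inj.
  - by move=> a; exact: sparse_perm_dist (valP a).
  - by move=> a k; rewrite perm_class_size; exact: base_bal.
  - exact: base_bal.
have e1 : n0 = 1%N by lia.
have [card1 lnA] := @ln_card_single_moves R n m m2 nm.
have := @dynamic_testing (option ('I_(@mobile_rows n m) * 'I_(@code_size m).-1))
  (@single_move n m m2) hatLam hn0.
rewrite !e1; apply=> //.
- exact: single_move_good.
- exact: single_move_inj.
- exact: single_move_dist.
- exact: (single_move_sizes m2 nm balq balr (bal1 e1)).
- exact: base_bal.
Qed.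

End Balanced.
End ClusteringTerms.

(** * Connectivity term *)

Section ConnectivityTerm.
Context {R : realType} {n m L T : nat} {H : 'M[R]_L}.
Context (m0 : (0 < m)%N) (nm : (2 * m <= n)%N) (T0 : (0 < T)%N) (TL : (T < L)%N).
Hypotheses (Horth : orthogonal_mx H) (Hflat : flat_on_binary H)
  (Hones : maps_ones_to_e1 H).
Implicit Types w : {ffun upair m * 'I_T -> bool}.

(* Frequency 0, which carries the mean 1/2, is left alone. *)
Definition freq (l : 'I_L) : option 'I_T := if (0 < l)%N then insub l.-1 else None.

Lemma freq_card t : #|[pred l | freq l == Some t]| = 1%N.
Proof.
have lt : (t.+1 < L)%N := leq_ltn_trans (ltn_ord t) TL.
rewrite -(card1 (Ordinal lt)); apply: eq_card => l; rewrite !inE /freq.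
apply/eqP/eqP => [|->] /=.
  case: posnP => // l0; case: insubP => // t' _ et [tt'].
  by apply: val_inj => /=; rewrite -tt' et prednK.
by case: insubP => [t' _ et|]; [congr Some; apply: val_inj|rewrite ltn_ord].
Qed.

Lemma sum_freq (F : option 'I_T -> R) : F None = 0 ->
  \sum_l F (freq l) = \sum_t F (Some t).
Proof. by move=> F0; rewrite (sum_layers freq_card) // mul1r. Qed.

Definition spectrum w e : 'cV[R]_L :=
  \col_l (if freq l is Some t then (w (e, t))%:R else 0).

Definition signal w e (l : 'I_L) : R := (H^T *m spectrum w e) l 0.

(** Parseval: [H^T] preserves the Euclidean norm, and the difference of two spectra has entries 0 or
    of modulus 1. *)
Lemma sqr_signal_dist w w' e :
  \sum_l (signal w e l - signal w' e l) ^+ 2 = \sum_t (w (e, t) != w' (e, t))%:R.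
Proof.
pose v := spectrum w e - spectrum w' e.
transitivity (((H^T *m v)^T *m (H^T *m v)) 0 0).
  rewrite mxE; apply: eq_bigr => l _.
  have -> : signal w e l - signal w' e l = (H^T *m v) l 0.
    by rewrite /v mulmxBr [RHS]mxE [X in _ = _ + X]mxE.
  by rewrite [X in _ = X * _]mxE expr2.
rewrite trmx_mul trmxK mulmxA -[v^T *m H *m H^T]mulmxA Horth mulmx1 mxE.
pose F o : R := if o is Some t then (w (e, t) != w' (e, t))%:R else 0.
rewrite -(sum_freq (F := F)) //; apply: eq_bigr => l _; rewrite !mxE /F.
case: (freq l) => [t|]; last by rewrite subrr mulr0.
by case: (w _); case: (w' _); rewrite /= ?subrr ?mulr0 ?subr0 ?mulr1 // sub0r mulrNN mulr1.
Qed.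

Lemma sum_bool_le (b : 'I_T -> bool) : \sum_t (b t)%:R <= T%:R :> R.
Proof.
rewrite -[in leRHS](card_ord T) -sum1_card natr_sum.
by apply: ler_sum => t _; rewrite ler_nat leq_b1.
Qed.

(** The spectrum is binary with at most [T] ones, so flatness of [H] applies; the factor 1 / sqrt L
    is given away. *)
Lemma signal_le w e l : `|signal w e l| <= T%:R.
Proof.
have bin k : spectrum w e k 0 = 0 \/ spectrum w e k 0 = 1.
  by rewrite mxE; case: (freq k) => [t|]; [case: (w _); [right|left]|left].
apply: le_trans (Hflat bin l) _.
have L1 : 1 <= Num.sqrt L%:R :> R.
  by rewrite -[leLHS]sqrtr1 ler_wsqrtr // ler1n (ltn_trans T0).
rewrite ler_pdivrMr; last exact: lt_le_trans L1.
apply: (@le_trans _ _ T%:R); last by rewrite ler_peMr.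
pose F o : R := if o is Some t then (w (e, t))%:R else 0.
rewrite (eq_bigr (fun l => F (freq l))); last first.
  by move=> k _; rewrite mxE /F; case: (freq k) => [t|]; rewrite ?normr_nat ?normr0.
by rewrite sum_freq // sum_bool_le.
Qed.

Lemma sorted_subproof (k k' : 'I_m) :
  ((if (k <= k')%N then (k, k') else (k', k)).1 <=
   (if (k <= k')%N then (k, k') else (k', k)).2)%N.
Proof. by case: (leqP k k') => // /ltnW. Qed.

Definition sorted_pair k k' : upair m :=
  exist (fun p : 'I_m * 'I_m => is_true (p.1 <= p.2)%N) _ (sorted_subproof k k').

Lemma sorted_pairC k k' : sorted_pair k k' = sorted_pair k' k.
Proof.
apply: val_inj => /=; case: (ltngtP k k') => //= e.
by rewrite (val_inj e).
Qed.

Lemma sorted_pair_val (e : upair m) : sorted_pair (val e).1 (val e).2 = e.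
Proof. by apply: val_inj => /=; rewrite (valP e); case: (val e). Qed.

Section Amplitude.
Context (a : R) (a0 : 0 < a) (aT : a * T%:R <= 4^-1).

Definition signal_conn w : tensor R m L :=
  [ffun x : 'I_m * 'I_m * 'I_L =>
     2^-1 + a * signal w (sorted_pair x.1.1 x.1.2) x.2].

Definition signal_tensor w : tensor R n L :=
  [ffun x : 'I_n * 'I_n * 'I_L => if x.1.1 == x.1.2 then 0
     else 2^-1 + a * signal w (sorted_pair (base m0 x.1.1) (base m0 x.1.2)) x.2].

Lemma signal_bounds w e l : 4^-1 <= 2^-1 + a * signal w e l <= 3 / 4.
Proof.
have : `|a * signal w e l| <= 4^-1.
  rewrite normrM gtr0_norm //; apply: le_trans aT.
  by rewrite ler_pM2l // signal_le.
by rewrite ler_norml => /andP[? ?]; apply/andP; split; lra.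
Qed.

Lemma signal_tensor_bounds w x : above_diag x -> 4^-1 <= signal_tensor w x <= 3 / 4.
Proof.
move=> ux; rewrite ffunE ifN; first exact: signal_bounds.
by apply: contraL ux => /eqP; rewrite /above_diag => ->; rewrite ltnn.
Qed.

Lemma signal_tensor_dsbm w :
  dsbm_tensor (signal_conn w) (fun=> label_mx (base m0)) (signal_tensor w).
Proof.
split=> [i l|i j l k k' ij]; first by rewrite ffunE eqxx.
by rewrite !mxE !ffunE /= (negbTE ij) => /eqP -> /eqP ->.
Qed.

(** Beyond frequency 0 the rows of [H] sum to zero, so the mean 1/2 disappears and D is [a] times
    the binary spectrum. At most [T] frequencies remain, each of weight at most T^(2 nu0). *)
Lemma signal_conn_smooth (nu0 K0 : R) w : 0 < nu0 ->
  a ^+ 2 * (T%:R * T%:R `^ (2 * nu0)) <= K0 ->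
  smooth_class H nu0 K0 (signal_conn w).
Proof.
move=> nu00 aK; split.
  split=> [x|k k' l]; last by rewrite !ffunE /= sorted_pairC.
  by rewrite ffunE; have /andP[? ?] := signal_bounds w
    (sorted_pair x.1.1 x.1.2) x.2; apply/andP; split; lra.
move=> D k; set e := enum_val k.
have DE (l : 'I_L) : (0 < l)%N -> D k l = a * spectrum w e l 0.
  move=> l0; rewrite /D mxE.
  transitivity (\sum_j (2^-1 * H l j + a * (H l j * (H^T *m spectrum w e) j 0))).
    apply: eq_bigr => j _; rewrite -/(signal w e j) [Qmx _ _ _]mxE [H^T _ _]mxE /=.
    by rewrite ffunE /= sorted_pair_val; ring.
  rewrite big_split /= -!mulr_sumr.
  have -> : \sum_j H l j = 0.
    have /colP/(_ l) := Hones; rewrite mxE [in RHS]mxE [in RHS]mxE (gtn_eqF l0) mulr0.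
    by move=> e0; rewrite -[RHS]e0; apply: eq_bigr => j _; rewrite mxE mulr1.
  rewrite mulr0 add0r; congr (_ * _).
  by rewrite -[in RHS](mul1mx (spectrum w e)) -Horth -mulmxA [in RHS]mxE.
apply: le_trans aK.
pose F (o : option 'I_T) : R := if o is Some t then a ^+ 2 * (T%:R `^ (2 * nu0)) else 0.
apply: (@le_trans _ _ (\sum_(l < L) F (freq l))); last first.
  by rewrite sum_freq // /F sumr_const card_ord -[leLHS]mulr_natr; lra.
apply: ler_sum => l _; case: (posnP l) => [l0|l0].
  rewrite l0 powR0 ?mul0r; last by rewrite gt_eqF //; lra.
  by rewrite /F /freq l0.
rewrite DE // mxE exprMn mulrCA /F /freq l0.
case: insubP => [t _ et|_]; last by rewrite expr0n !mulr0.
rewrite ler_wpM2l ?sqr_ge0 //.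
have : l%:R `^ (2 * nu0) <= T%:R `^ (2 * nu0) :> R.
  rewrite ge0_ler_powR ?nnegrE ?ler0n //; first by lra.
  by rewrite ler_nat -(prednK l0) -et ltn_ord.
have := powR_ge0 (l%:R : R) (2 * nu0); have := powR_ge0 (T%:R : R) (2 * nu0).
by case: (w _) => /=; rewrite ?expr1n ?expr0n ?mulr1 ?mulr0.
Qed.

Lemma signal_tensor_distE w w' :
  sqnorm (signal_tensor w - signal_tensor w') =
  a ^+ 2 * \sum_(i < n) \sum_(j < n) (if i == j then 0 else
    \sum_t (w (sorted_pair (base m0 i) (base m0 j), t) !=
            w' (sorted_pair (base m0 i) (base m0 j), t))%:R).
Proof.
rewrite sqnormE exchange_big /= mulr_sumr; apply: eq_bigr => i _.
rewrite exchange_big /= mulr_sumr; apply: eq_bigr => j _.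
case: (eqVneq i j) => [->|ij].
  by rewrite mulr0 big1 // => l _; rewrite !ffunE /= eqxx subrr expr0n.
rewrite -sqr_signal_dist mulr_sumr; apply: eq_bigr => l _.
by rewrite !ffunE /= (negbTE ij); ring.
Qed.

(** For every pair of classes, nodes taken from two distinct full rows give q (q - 1) ordered pairs,
    q = n / m; distinct rows ensure distinct nodes even when the classes coincide. *)
Lemma signal_tensor_dist_ge w w' :
  a ^+ 2 * ((n %/ m) * (n %/ m).-1)%:R * \sum_s (w s != w' s)%:R <=
  sqnorm (signal_tensor w - signal_tensor w').
Proof.
rewrite signal_tensor_distE -mulrA ler_wpM2l ?sqr_ge0 //.
pose d e : R := \sum_t (w (e, t) != w' (e, t))%:R.
have d0 e : 0 <= d e by rewrite sumr_ge0.
apply: (@le_trans _ _ (\sum_(r < n %/ m) \sum_(c < m) \sum_(r' < n %/ m) \sum_(c' < m)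
    (r != r')%:R * d (sorted_pair c c'))); last first.
  apply: (@sum_rows_le _ _ m0 _ 0) => //.
    by move=> i; rewrite sumr_ge0 // => j _; case: ifP => // _; exact: d0.
  move=> r c i ei; rewrite add0n in ei; apply: (@sum_rows_le _ _ m0 _ 0) => //.
    by move=> j; case: ifP => // _; exact: d0.
  move=> r' c' j ej; rewrite add0n in ej.
  have bi : base m0 i = c by apply: val_inj; apply: base_row ei => //.
  have bj : base m0 j = c' by apply: val_inj; apply: base_row ej => //.
  rewrite bi bj -/(d _).
  have [_|rr] := eqVneq r r'; first by rewrite mul0r; case: ifP.
  rewrite mul1r ifN //; apply: contra rr => /eqP ij; apply/eqP/val_inj => /=.
  by have := congr1 (fun i : 'I_n => i %/ m)%N ij; rewrite /= ei ej !divn_row.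
rewrite (eq_bigr (fun r : 'I_(n %/ m) => \sum_(r' < n %/ m) (r != r')%:R *
    \sum_(c < m) \sum_(c' < m) d (sorted_pair c c'))); last first.
  move=> r _; rewrite exchange_big /=; apply: eq_bigr => r' _.
  by rewrite mulr_sumr; apply: eq_bigr => c _; rewrite mulr_sumr.
set D := \sum_(c < m) _.
rewrite [leRHS](eq_bigr (fun=> (n %/ m).-1%:R * D)); last first.
  move=> r _; rewrite -mulr_suml (bigD1 r) //= eqxx add0r; congr (_ * _).
  rewrite (eq_bigr (fun=> 1)); last by move=> r' ; rewrite eq_sym => ->.
  rewrite sumr_const; congr _%:R; have := cardC1 r; rewrite card_ord => <-.
  by apply: eq_card => r'; rewrite !inE.
rewrite sumr_const card_ord -[leRHS]mulr_natl mulrA -natrM ler_wpM2l //.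
apply: (@le_trans _ _ (\sum_e d e)).
  rewrite /d pair_bigA /=; apply: ler_sum => -[e t] _; exact: lexx.
rewrite /D [leRHS]pair_bigA /=.
apply: le_trans (@ler_sum_inj R _ _ _ (fun p => d (sorted_pair p.1 p.2)) val_inj _) => //.
by apply: ler_sum => e _; rewrite sorted_pair_val.
Qed.

End Amplitude.

(** The source of the constant 35: exp (-35) <= 1/36 <= ln 2 / 18. *)
Lemma binary_sum_le (b : bool) :
  \sum_b' expR (- 35 * (b != b')%:R) <= expR (ln 2 / 18) :> R.
Proof.
have e35 : expR (- 35) <= 36^-1 :> R.
  have le36 : 36 <= expR 35 :> R by have := expR_ge1Dx (35 : R); lra.
  by rewrite expRN lef_pV2 // posrE ?expR_gt0.
have := expR_ge1Dx (ln 2 / 18 : R); have := @ln2_ge R.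
by rewrite big_bool; case: b => /=; rewrite !(mulr1, mulr0, expR0); lra.
Qed.

Lemma card_upair_ge : (m ^ 2 <= 2 * #|{: upair m}|)%N.
Proof. by rewrite card_upair -mulnn; nia. Qed.

Lemma quotient_pairs_ge : (n ^ 2 <= 8 * m ^ 2 * (n %/ m * (n %/ m).-1))%N.
Proof.
have q2 : (2 <= n %/ m)%N by rewrite leq_divRL.
apply: (@leq_trans (((n %/ m).+1 * m) ^ 2)); first by rewrite leq_sqr ltnW // ltn_ceil.
rewrite expnMn mulnAC leq_mul2r; apply/orP; right.
by move: (n %/ m)%N q2 => [|[|q]] // _; rewrite -mulnn /=; nia.
Qed.

Lemma connectivity_testing (nu0 K0 ka : R) (CC : set ('I_L -> 'M[bool]_(n, m)))
    (hatLam : tensor bool n L -> tensor R n L) :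
  0 < nu0 -> 0 < ka <= 24^-1 -> ka ^+ 2 <= K0 ->
  T%:R <= n%:R / m%:R :> R ->
  (m%:R / n%:R) ^+ 2 * (T%:R * T%:R `^ (2 * nu0)) <= 1 ->
  CC (fun=> label_mx (base m0)) ->
  exists2 Lam, dsbm_class (smooth_class (m := m) H nu0 K0) CC Lam &
    4^-1 <= Pr Lam (fun B => ka ^+ 2 / (32 * 72 * 35) * (m%:R ^+ 2 * T%:R)
      <= sqnorm (hatLam B - Lam)).
Proof.
move=> nu00 /andP[ka0 ka24] kaK Tnm Tpow CCbase.
have n0 : (0 < n)%N by apply: leq_trans nm; rewrite muln_gt0.
have mR : 0 < m%:R :> R by rewrite ltr0n.
have nR : 0 < n%:R :> R by rewrite ltr0n.
have TR : 0 < T%:R :> R by rewrite ltr0n.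
(* A pair of classes covers about (n / m)^2 entries, so with this amplitude one bit of the
   hypothesis contributes a constant of order ka^2 to the squared distance. *)
pose a := ka * (m%:R / n%:R).
have a0 : 0 < a by rewrite mulr_gt0 // divr_gt0.
have aT : a * T%:R <= 4^-1.
  apply: (@le_trans _ _ ka); last by lra.
  rewrite /a -mulrA ler_piMr ?(ltW ka0) //.
  by move: Tnm; rewrite ler_pdivlMr // mulrAC ler_pdivrMr // mul1r mulrC.
have aK : a ^+ 2 * (T%:R * T%:R `^ (2 * nu0)) <= K0.
  by apply: le_trans kaK; rewrite /a exprMn -mulrA ler_piMr // sqr_ge0.
have S0 : 0 < #|{: upair m}|%:R :> R.
  rewrite ltr0n -(ltn_pmul2l (isT : 0 < 2)%N) muln0.
  by apply: leq_trans card_upair_ge; rewrite expn_gt0 m0.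
have Sm : m%:R ^+ 2 <= 2 * #|{: upair m}|%:R :> R.
  by rewrite -natrX -natrM ler_nat card_upair_ge.
have qn : n%:R ^+ 2 <= 8 * m%:R ^+ 2 * (n %/ m * (n %/ m).-1)%:R :> R.
  by rewrite -!natrX -!natrM ler_nat quotient_pairs_ge.
have ln2 := @ln2_ge R.
have mT : m%:R ^+ 2 * T%:R / 4 <= #|{: upair m}|%:R * T%:R * ln 2 :> R.
  have := ler_wpM2r (ltW TR) Sm; have := ler_wpM2l (ltW (mulr_gt0 S0 TR)) ln2.
  lra.
pose gam := a ^+ 2 * (n %/ m * (n %/ m).-1)%:R.
have aE : a ^+ 2 * n%:R ^+ 2 = ka ^+ 2 * m%:R ^+ 2.
  by rewrite /a; field; rewrite gt_eqF.
have gam8 : ka ^+ 2 / 8 <= gam.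
  rewrite ler_pdivrMr // -(ler_pM2r (exprn_gt0 2 mR)) -aE /gam.
  by have := ler_wpM2l (sqr_ge0 a) qn; lra.
have gam0 : 0 < gam by apply: lt_le_trans gam8; rewrite divr_gt0 // exprn_gt0.
have cardS : #|{: upair m * 'I_T}|%:R = #|{: upair m}|%:R * T%:R :> R.
  by rewrite card_prod card_ord natrM.
have cardb : #|{: bool}|%:R = 2 :> R by rewrite card_bool.
have [] := @product_testing R n L (upair m * 'I_T)%type bool (signal_tensor a)
  (signal_tensor a [ffun=> false]) (fun b b' => (b != b')%:R) 35 gam hatLam _ _ _ gam0.
- by rewrite -(ltr0n R) cardS mulr_gt0.
- by rewrite card_bool.
- by [].
- move=> w x ux; have /andP[? ?] := signal_tensor_bounds a0 aT w ux.
  by apply/andP; split; lra.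
- by move=> x; exact: signal_tensor_bounds.
- by move=> w w'; exact: signal_tensor_dist_ge.
- by move=> b; rewrite cardb; exact: binary_sum_le.
- move=> w; rewrite cardb cardS signal_tensor_distE.
  apply: (@le_trans _ _ (6 * (a ^+ 2 * (n%:R ^+ 2 * T%:R)))).
    rewrite !ler_wpM2l ?sqr_ge0 //.
    apply: (@le_trans _ _ (\sum_(i < n) \sum_(j < n) T%:R)).
      apply: ler_sum => i _; apply: ler_sum => j _; case: ifP => // _.
      exact: sum_bool_le.
    by rewrite !sumr_const card_ord -mulrnA -[leLHS]mulr_natr natrM; lra.
  rewrite (mulrA (a ^+ 2)) aE.
  (* The divergence 6 ka^2 m^2 T is then at most m^2 T / 96, below the budget m^2 T / 72 that [mT]
     provides. *)
  have k2 : ka ^+ 2 <= 24^-1 ^+ 2 by rewrite lerXn2r ?nnegrE //; lra.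
  have mT0 : 0 <= m%:R ^+ 2 * T%:R :> R by rewrite mulr_ge0 ?sqr_ge0.
  by have := ler_wpM2r mT0 k2; lra.
move=> w large; exists (signal_tensor a w).
  exists (signal_conn a w), (fun=> label_mx (base m0)).
  split => //; last exact: signal_tensor_dsbm.
  exact: signal_conn_smooth.
apply: le_trans large _; apply: le_Pr => [x ux|B].
  have /andP[? ?] := signal_tensor_bounds a0 aT w ux.
  by apply/andP; split; lra.
apply: le_trans; rewrite cardb cardS.
have mT0 : 0 <= m%:R ^+ 2 * T%:R / 4 :> R by rewrite divr_ge0 // mulr_ge0 ?sqr_ge0.
have k0 : 0 <= ka ^+ 2 / 8 by rewrite divr_ge0 // sqr_ge0.
by have := ler_pM k0 mT0 gam8 mT; lra.
Qed.

End ConnectivityTerm.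

(** * The lower bound *)

(** The ideal bandwidth y = (n / m)^(2 / (2 nu0 + 1)) solves x y^(2 nu0 + 1) = 1, and x y is the
    power of x in the rate. The condition nu0 > 1/2 makes its exponent at most 1, so that y <= n /
    m. *)
Lemma bandwidth_exists (R : realType) (m n L : nat) (nu0 : R) :
  (0 < m)%N -> (2 * m <= n)%N -> (2 <= L)%N -> 2^-1 < nu0 ->
  let x : R := (m%:R / n%:R) ^+ 2 in
  exists T : nat, [/\ (0 < T < L)%N, T%:R <= n%:R / m%:R :> R,
    x * (T%:R * T%:R `^ (2 * nu0)) <= 1 &
    Num.min (L%:R^-1 * x `^ (2 * nu0 / (2 * nu0 + 1))) x <= 2 * (x * T%:R / L%:R)].
Proof.
move=> m0 nm L2 nu0_half x.
have mR : 0 < m%:R :> R by rewrite ltr0n.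
have nR : 0 < n%:R :> R by rewrite ltr0n; lia.
have LR : 0 < L%:R :> R by rewrite ltr0n; lia.
pose b : R := m%:R / n%:R.
have b0 : 0 < b by rewrite divr_gt0.
have b1 : 0 < b <= 1 by rewrite b0 ler_pdivrMr // mul1r ler_nat; lia.
have bn0 : b != 0 by rewrite gt_eqF.
pose e := (2 * nu0 + 1)^-1.
have ne : (2 * nu0 + 1) * e = 1 by rewrite divff // gt_eqF //; lra.
have e0 : 0 < e by rewrite invr_gt0; lra.
have e2 : 2 * e <= 1 by nra.
pose y := b `^ (- (2 * e)).
have y1 : 1 <= y.
  by rewrite -[leLHS](powRr0 b) ger_powR //; lra.
have yb : y <= b^-1.
  by rewrite -powR_inv1 ?(ltW b0) // ger_powR //; lra.
have bD r s : b `^ (r + s) = b `^ r * b `^ s by rewrite powRD // bn0 implybT.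
have xE : x = b `^ 2 by rewrite -[2]/(2%:R) powR_mulrn // ltW.
have ypow : x * y `^ (2 * nu0 + 1) = 1.
  rewrite xE -powRrM -bD (_ : 2 + _ = 0) ?powRr0 //.
  by rewrite mulNr -mulrA (mulrC e) ne; lra.
have xy : x * y = x `^ (2 * nu0 / (2 * nu0 + 1)).
  rewrite xE /y -bD -powRrM; congr (_ `^ _).
  by have : 2 * nu0 / (2 * nu0 + 1) = 1 - e; [rewrite -/e; lra|move=> ->; lra].
have x0 : 0 < x by rewrite exprn_gt0.
(* Frequency 0 is excluded, hence [L.-1]. Either reduction loses at most a factor 2, because L >= 2
   and y >= 1. *)
exists (minn L.-1 (Num.truncn y)).
set T := minn _ _.
have T0 : (0 < T)%N.
  by rewrite /T leq_min -ltnS prednK ?L2 ?(ltnW L2) //= lt0n -leqn0 truncn_le_nat -leNgt.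
have Ty : T%:R <= y.
  apply: (@le_trans _ _ (Num.truncn y)%:R); first by rewrite ler_nat geq_minr.
  by rewrite truncn_le (le_trans ler01).
have T0R : 0 < T%:R :> R by rewrite ltr0n.
split.
- by rewrite T0 (leq_ltn_trans (geq_minl _ _)) // ltn_predL ltnW.
- by apply: le_trans Ty (le_trans yb _); rewrite invf_div.
- rewrite -[leRHS]ypow ler_pM2l //.
  rewrite (_ : T%:R * _ = T%:R `^ (2 * nu0 + 1)); last first.
    rewrite (addrC (2 * nu0)) powRD ?powRr1 ?(ltW T0R) //.
    by apply/implyP => _; rewrite gt_eqF.
  by rewrite ge0_ler_powR ?nnegrE ?(ltW T0R) ?(le_trans ler01) //; lra.
have LV : 0 < L%:R^-1 :> R by rewrite invr_gt0.
have [LT|yT] : L%:R <= 2 * T%:R :> R \/ y <= 2 * T%:R.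
  rewrite /T; case: leqP => _.
    by left; rewrite -natrM ler_nat; move: L2; clear; lia.
  right; have := truncn_le_nat y (Num.truncn y); rewrite leqnn => /esym lt.
  have : 1 <= (Num.truncn y)%:R :> R by rewrite ler1n; move: T0; rewrite /T leq_min => /andP[].
  by move: lt; rewrite -natr1; lra.
- rewrite ge_min; apply/orP; right.
  rewrite -mulrA mulrCA ler_peMr ?(ltW x0) //.
  by rewrite mulrA ler_pdivlMr // mul1r.
- rewrite ge_min; apply/orP; left; rewrite -xy mulrC mulrA ler_pM2r //.
  by rewrite mulrCA ler_pM2l.
Qed.

Lemma dsbm_class_prob (R : realType) (m n L : nat) (GG : set (tensor R m L))
    (CC : set ('I_L -> 'M[bool]_(n, m))) Lam :
  (forall G, GG G -> connectivity G) -> (forall C, CC C -> forall l, clustering (C l)) ->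
  dsbm_class GG CC Lam -> prob_tensor Lam.
Proof.
move=> GGc CCc [G [C [GG_G CC_C [_ LamG]]]] [[i j] l] ij.
have class_of i' : exists k, C l i' k.
  have : #|[set k | C l i' k]%SET| != 0%N by rewrite (CCc _ CC_C l i').
  by rewrite cards_eq0 => /set0Pn[k]; rewrite inE; exists k.
have [[k Ck] [k' Ck']] := (class_of i, class_of j).
rewrite (LamG i j l k k') //; first by have [] := GGc _ GG_G.
by apply: contraTneq ij => ->; rewrite /above_diag ltnn.
Qed.

Lemma le_3half L : (2 <= L -> L <= 3 * L./2)%N.
Proof. by lia. Qed.

Lemma clustering_m1 n (Z Z' : 'M[bool]_(n, 1)) : clustering Z -> clustering Z' -> Z = Z'.
Proof.
suff all_true (Y : 'M[bool]_(n, 1)) : clustering Y -> forall i k, Y i k = true.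
  by move=> cZ cZ'; apply/matrixP => i k; rewrite !all_true.
move=> cY i k; have : #|[set k | Y i k]%SET| != 0%N by rewrite (cY i).
by rewrite cards_eq0 => /set0Pn[k0]; rewrite inE !ord1.
Qed.

Local Open Scope classical_set_scope.
Local Open Scope ring_scope.

Theorem theorem4 (R : realType) (al1 al2 nu0 K0 : R)
    (hal1 : 0 < al1) (hal1' : al1 <= 1) (hal2 : 1 <= al2)
    (hnu0 : 2^-1 < nu0) (hK0 : 0 < K0) :
  exists2 C0 : R, 0 < C0 &
  forall (m n L n0 : nat) (H : 'M[R]_L),
    (1 <= m)%N -> (2 * m <= n)%N -> (2 <= L)%N -> (n0 <= n)%N ->
    orthogonal_mx H -> flat_on_binary H -> maps_ones_to_e1 H ->
    (* the class Z_bal is nonempty and, when n0 > 0, not all of its sequences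
       are constant in time *)
    (Zbal m n L n0 al1 al2 : set _) !=set0 ->
    ((0 < n0)%N -> exists (C : 'I_L -> 'M[bool]_(n, m)) (l l' : 'I_L),
       Zbal m n L n0 al1 al2 C /\ C l <> C l') ->
  ((4^-1)%:E <=
    ereal_inf [set
      ereal_sup [set
        (Pr Lam (fun B => (C0 * rate m n L n0 nu0 <=
                           sqnorm (hatLam B - Lam) / (n%:R ^+ 2 * L%:R))%R))%:E
        | Lam in dsbm_class (smooth_class (m := m) H nu0 K0)
                          (Zbal m n L n0 al1 al2)]
      | hatLam in [set: tensor bool n L -> tensor R n L]])%E.
Proof.
have nu00 : 0 < nu0 by lra.
(* As ka <= 1, the bound ka <= K0 already gives ka^2 <= K0. *)
pose ka := Num.min 24^-1 K0.
have ka0 : 0 < ka by rewrite lt_min hK0 invr_gt0 ltr0n.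
have ka24 : 0 < ka <= 24^-1 by rewrite ka0 ge_min lexx.
have kaK : ka ^+ 2 <= K0.
  apply: (@le_trans _ _ ka); last by rewrite ge_min lexx orbT.
  by rewrite expr2 ler_piMr ?(ltW ka0) //; lra.
pose cA : R := ka ^+ 2 / (32 * 72 * 35).
have cA0 : 0 < cA by rewrite divr_gt0 ?exprn_gt0 // !mulr_gt0 ?ltr0n.
pose cB := @clustering_const R.
have cB0 : 0 < cB := clustering_const_gt0.
(* The 2 is lost in the choice of the bandwidth, the 3 in L <= 3 (L./2) for the number of odd
   times. *)
pose c := Num.min (cA / 2) (cB / 3).
have c0 : 0 < c by rewrite lt_min; apply/andP; split; apply: divr_gt0.
have ccA : c <= cA / 2 by rewrite ge_min lexx.
have ccB : c <= cB / 3 by rewrite ge_min lexx orbT.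
exists (c / 3); first by rewrite divr_gt0 ?ltr0n.
move=> m n L n0 H m0 nm L2 n0n Horth Hflat Hones [C1 C1bal] nonconst.
have mn : (m <= n)%N := leq_trans (leq_pmull m (isT : 0 < 2)%N) nm.
have nR : 0 < n%:R :> R by rewrite ltr0n (leq_trans m0).
have mR : 1 <= m%:R :> R by rewrite ler1n.
have LR : 0 < L%:R :> R by rewrite ltr0n ltnW.
have nL0 : 0 < n%:R ^+ 2 * L%:R :> R by rewrite mulr_gt0 // exprn_gt0.
have [balq balr] := balanced_quotient m0 hal1' hal2 (Ordinal (ltnW L2)) C1bal.
set GG := smooth_class H nu0 K0; set CC := Zbal m n L n0 al1 al2.
suff bound hatLam : exists2 Lam, dsbm_class GG CC Lam & exists2 D : R,
    c / 3 * rate m n L n0 nu0 <= D / (n%:R ^+ 2 * L%:R) &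
    4^-1 <= Pr Lam (fun B => D <= sqnorm (hatLam B - Lam)).
  apply/ereal_infP => _ [hatLam _ <-].
  have [Lam LamC [D leD large]] := bound hatLam.
  apply: (@ereal_sup_ge R); exists (Pr Lam (fun B => (c / 3 * rate m n L n0 nu0 <=
      sqnorm (hatLam B - Lam) / (n%:R ^+ 2 * L%:R))%R))%:E; first by exists Lam.
  rewrite lee_fin (le_trans large) // le_Pr //.
    apply: dsbm_class_prob LamC => [G []//|C []//].
  move=> B leDB; apply: le_trans leD _.
  by rewrite ler_pM2r ?invr_gt0.
rewrite /rate; set x : R := (m%:R / n%:R) ^+ 2.
set T1 := Num.min _ _; set T2 := ln _ / _; set T3 := _ * ln _.
have T10 : 0 <= T1.
  by rewrite le_min sqr_ge0 andbT mulr_ge0 ?powR_ge0 // invr_ge0 ltW.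
have T20 : 0 <= T2 by rewrite divr_ge0 ?ln_ge0 // mulr_ge0 // ltW.
have claimA : exists2 Lam, dsbm_class GG CC Lam & exists2 D : R,
    c * T1 <= D / (n%:R ^+ 2 * L%:R) &
    4^-1 <= Pr Lam (fun B => D <= sqnorm (hatLam B - Lam)).
  have [T [/andP[T0 TL] Tnm Tpow T1le]] := bandwidth_exists m0 nm L2 hnu0.
  have baseC : CC (fun=> label_mx (base m0)).
    apply: label_mx_Zbal => [l l' _|l k]; first by rewrite hdistxx.
    exact: base_balanced.
  have [Lam LamC large] := connectivity_testing nm T0 TL Horth Hflat Hones hatLam
    nu00 ka24 kaK Tnm Tpow baseC.
  exists Lam => //; eexists; last exact: large.
  apply: (@le_trans _ _ (cA / 2 * (2 * (x * T%:R / L%:R)))).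
    by rewrite ler_pM // ltW.
  rewrite le_eqVlt; apply/orP; left; apply/eqP; rewrite /x /cA.
  by field; rewrite !gt_eqF.
have claimB : (2 <= m)%N -> exists2 Lam, dsbm_class GG CC Lam & exists2 D : R,
    c * T2 <= D / (n%:R ^+ 2 * L%:R) &
    4^-1 <= Pr Lam (fun B => D <= sqnorm (hatLam B - Lam)).
  move=> m2.
  have [Lam LamC large] := static_lower_bound (n0 := n0) m2 nm L2 nu00 (ltW hK0) Hones
    balq balr hatLam.
  exists Lam => //; eexists; last exact: large.
  have lnm : ln m%:R <= log_moves (n := n) (m := m) n :> R.
    rewrite /log_moves ler_ln ?posrE ?divr_gt0 ?mulr_gt0 ?expR_gt0 //; try lra.
    rewrite mulrAC mulfK ?gt_eqF // ler_peMr //.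
    by rewrite -[leLHS]expR0 ler_expR.
  have lnm0 : 0 <= ln m%:R :> R by rewrite ln_ge0.
  apply: (@le_trans _ _ (cB * T2)).
    by rewrite ler_wpM2r // (le_trans ccB) // ler_pdivrMr // ler_peMr ?(ltW cB0) //; lra.
  rewrite /T2 (_ : cB * _ = cB * (n%:R * ln m%:R) / (n%:R ^+ 2 * L%:R)).
    by rewrite ler_pM2r ?invr_gt0 // ler_pM2l // ler_pM2l.
  by field; rewrite !gt_eqF.
have claimC : (0 < n0)%N -> exists2 Lam, dsbm_class GG CC Lam & exists2 D : R,
    c * T3 <= D / (n%:R ^+ 2 * L%:R) &
    4^-1 <= Pr Lam (fun B => D <= sqnorm (hatLam B - Lam)).
  move=> n00; have [C [l [l' [CCC neq]]]] := nonconst n00.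
  (* With a single class every sequence of clusterings is constant. *)
  have m2 : (2 <= m)%N.
    rewrite ltn_neqAle m0 andbT; apply/eqP => m1; apply: neq; move: CCC => [clC _ _].
    by subst m; apply: clustering_m1.
  have hn0 : (0 < n0 <= n)%N by rewrite n00.
  have bal1 : n0 = 1%N -> (m %| n)%N ->
      @balanced R m n al1 al2 (n %/ m).-1 /\ @balanced R m n al1 al2 (n %/ m).+1.
    move=> n01 dvd; subst n0; exact: balanced_neighbours CCC neq dvd.
  have [Lam LamC large] := dynamic_lower_bound (n0 := n0) m2 nm L2 nu00 (ltW hK0) Hones balq balr
    hatLam hn0 bal1.
  exists Lam => //; eexists; last exact: large.
  have l1 := @log_moves_ge1 R n m m2 n0 hn0.
  rewrite /T3 -/(log_moves n0); set lm := log_moves n0 in l1 *.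
  have nlm : 0 <= n0%:R * lm by rewrite mulr_ge0 //; lra.
  have L3 : L%:R <= 3 * (L./2)%:R :> R by rewrite -natrM ler_nat le_3half.
  rewrite ler_pdivlMr //.
  apply: (@le_trans _ _ (cB / 3 * (L%:R * (n0%:R * lm)))).
    rewrite (_ : c * _ * _ = c * (L%:R * (n0%:R * lm))).
      by rewrite ler_wpM2r // mulr_ge0 // ltW.
    by field; rewrite gt_eqF.
  rewrite -mulrA ler_pM2l // mulrA ler_wpM2r //; lra.
(* Only the largest of the three terms has to be attained, which costs the factor 3 in C0. *)
have third T : T1 <= T -> T2 <= T -> T3 <= T -> c / 3 * (T1 + T2 + T3) <= c * T.
  by move=> ? ? ?; rewrite -mulrA ler_pM2l //; lra.
have finish T : T1 <= T -> T2 <= T -> T3 <= T ->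
    (exists2 Lam, dsbm_class GG CC Lam & exists2 D : R, c * T <= D / (n%:R ^+ 2 * L%:R) &
      4^-1 <= Pr Lam (fun B => D <= sqnorm (hatLam B - Lam))) ->
    exists2 Lam, dsbm_class GG CC Lam & exists2 D : R,
      c / 3 * (T1 + T2 + T3) <= D / (n%:R ^+ 2 * L%:R) &
      4^-1 <= Pr Lam (fun B => D <= sqnorm (hatLam B - Lam)).
  move=> le1 le2 le3 [Lam LamC [D leD large]]; exists Lam => //; exists D => //.
  exact: le_trans (third T le1 le2 le3) leD.
(* Since T1 >= 0, the degenerate cases take care of themselves: T2 > T1 excludes m = 1, where ln m =
   0, and T3 > T1 excludes n0 = 0, where T3 = 0. *)
have [T21|T12] := leP T2 T1; have [T31|T13] := leP T3 T1.
- exact: (finish T1).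
- apply: (finish T3) => //; [exact: ltW|by lra|apply: claimC].
  by rewrite lt0n; apply: contraTneq T13 => n00; rewrite /T3 n00 !mul0r -leNgt.
- apply: (finish T2) => //; [exact: ltW|by lra|apply: claimB].
  rewrite ltn_neqAle m0 andbT; apply: contraTneq T12 => m1.
  by rewrite /T2 -m1 ln1 mul0r -leNgt.
have [T32|T23] := leP T3 T2.
  apply: (finish T2) => //; [exact: ltW|apply: claimB].
  rewrite ltn_neqAle m0 andbT; apply: contraTneq T12 => m1.
  by rewrite /T2 -m1 ln1 mul0r -leNgt.
apply: (finish T3) => //; [exact: ltW|exact: ltW|apply: claimC].
by rewrite lt0n; apply: contraTneq T13 => n00; rewrite /T3 n00 !mul0r -leNgt.
Qed.
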